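(* For all $n\ge1$ and $t\ge0$ one has the equalities of positive kernels $P^{n+1}_t\Lambda_{n,n+1}=\Lambda_{n,n+1}\hat P^n_t$ (as kernels from $W^{n+1}$ to $W^n$) and $\hat P^n_t\Lambda_{n,n}=\Lambda_{n,n}P^n_t$ (as kernels from $W^n$ to $W^n$). Explicitly, for $x\in W^{n+1}$, $y'\in W^n$: $$\sum_{x'\in W^{n+1}}\det(p_t(x_i,x'_j))_{i,j=1}^{n+1}\prod_{i=1}^n\hat\pi(y'_i)\mathbf 1(y'\in W^{n,n+1}(x'))=\sum_{y\in W^{n,n+1}(x)}\prod_{i=1}^n\hat\pi(y_i)\det(\hat p_t(y_i,y'_j))_{i,j=1}^n,$$ and for $x,y'\in W^n$: $$\sum_{x'\in W^{n}}\det(\hat p_t(x_i,x'_j))_{i,j=1}^{n}\prod_{i=1}^n\pi(y'_i)\mathbf 1(y'\in W^{n,n}(x'))=\sum_{y\in W^{n,n}(x)}\prod_{i=1}^n\pi(y_i)\det(p_t(y_i,y'_j))_{i,j=1}^n.$$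
   Context: Let $I=\mathbb N=\{0,1,2,\dots\}$ (with $l=0$) or $I=\mathbb Z$ (with $l=-\infty$). Let $\lambda,\mu:I\to[0,\infty)$ with $\lambda(x)>0$ and $\mu(x)>0$ for all $x\in I$, except that $\mu(0)=0$ when $I=\mathbb N$. Put $\pi(0)=1$, $\pi(x)=\prod_{i=1}^{x}\lambda(i-1)/\mu(i)$ for $x\ge1$ and $\pi(x)=\prod_{i=1}^{-x}\mu(x+i)/\lambda(x+i-1)$ for $x\le-1$. Assume $\pm\infty$ are natural boundaries: if $I=\mathbb N$, $\sum_{j\ge0}\frac{1}{\lambda(j)\pi(j)}\sum_{i=0}^{j}\pi(i)=\infty$ and $\sum_{j\ge0}\frac{1}{\lambda(j)\pi(j)}\sum_{i>j}\pi(i)=\infty$; if $I=\mathbb Z$, $\sum_{j\ge1}\frac{1}{\lambda(j)\pi(j)}\sum_{i=1}^{j}\pi(i)=\infty$, $\sum_{j\ge1}\pi(j)\sum_{i=1}^{j-1}\frac{1}{\lambda(i)\pi(i)}=\infty$, $\sum_{j\le-1}\frac{1}{\lambda(j)\pi(j)}\sum_{i=j+1}^{-1}\pi(i)=\infty$, $\sum_{j\le -1}\pi(j)\sum_{i=j}^{-1}\frac{1}{\lambda(i)\pi(i)}=\infty$. The $\mathcal D$-chain is the continuous-time Markov chain on $I$ jumping $x\to x+1$ at rate $\lambda(x)$ and $x\to x-1$ at rate $\mu(x)$; $p_t(x,y)$ denotes its transition probabilities. Its Siegmund dual, the $\hat{\mathcal D}$-chain, has rates $\hat\lambda(x)=\mu(x+1)$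 (for $x\to x+1$) and $\hat\mu(x)=\lambda(x)$ (for $x\to x-1$); when $I=\mathbb N$ it lives on $\{-1,0,1,\dots\}$ and is absorbed at $-1$. $\hat p_t(x,y)$, $x,y\in I$, denotes its transition probabilities restricted to $I$ (equivalently, those of the chain killed at $-1$). $\hat\pi(0)=1$, $\hat\pi(x)=\prod_{i=1}^x\mu(i)/\lambda(i)$ for $x\ge1$, $\hat\pi(x)=\prod_{i=1}^{-x}\lambda(x+i)/\mu(x+i)$ for $x\le-1$. $W^n=\{x\in I^n:x_1<\dots<x_n\}$. For $x\in W^{n+1}$, $W^{n,n+1}(x)=\{y\in W^n:x_1\le y_1<x_2\le y_2<\dots\le y_n<x_{n+1}\}$; for $x\in W^n$, $W^{n,n}(x)=\{y\in W^n:y_1\le x_1<y_2\le x_2<\dots<y_n\le x_n\}$. Karlin–McGregor kernels: $P^n_t(x,y)=\det(p_t(x_i,y_j))_{i,j=1}^n$ and $\hat P^n_t(x,y)=\det(\hat p_t(x_i,y_j))_{i,j=1}^n$ on $W^n$. $\Lambda_{n,n+1}(x,y)=\prod_{i=1}^n\hat\pi(y_i)\mathbf 1(y\in W^{n,n+1}(x))$ for $x\in W^{n+1},y\in W^n$; $\Lambda_{n,n}(x,y)=\prod_{i=1}^n\pi(y_i)\mathbf 1(y\in W^{n,n}(x))$ for $x,y\in W^n$. *)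

(* Defs.v *)
From Stdlib Require Import Reals ZArith List Bool Arith.
Import ListNotations.
Open Scope R_scope.

Definition inIb (isZ : bool) (x : Z) : bool := isZ || (0 <=? x)%Z.

(* sumZ a b f = sum_{i=a}^{b} f i  (0 if b < a) *)
Definition sumZ (a b : Z) (f : Z -> R) : R :=
  fold_right Rplus 0 (map (fun k => f (a + Z.of_nat k)%Z) (seq 0 (Z.to_nat (b - a + 1)))).
Definition prodZ (a b : Z) (f : Z -> R) : R :=
  fold_right Rmult 1 (map (fun k => f (a + Z.of_nat k)%Z) (seq 0 (Z.to_nat (b - a + 1)))).

Definition piF (lam mu : Z -> R) (x : Z) : R :=
  if (1 <=? x)%Z then prodZ 1 x (fun i => lam (i - 1)%Z / mu i)
  else if (x =? 0)%Z then 1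
  else prodZ 1 (- x) (fun i => mu (x + i)%Z / lam (x + i - 1)%Z).

Definition pihat (lam mu : Z -> R) (x : Z) : R :=
  if (1 <=? x)%Z then prodZ 1 x (fun i => mu i / lam i)
  else if (x =? 0)%Z then 1
  else prodZ 1 (- x) (fun i => lam (x + i)%Z / mu (x + i)%Z).

(* a series of nonnegative terms diverges: partial sums are unbounded *)
Definition unbounded (u : nat -> R) : Prop := forall M : R, exists J : nat, M < u J.

Definition natural_boundaries (isZ : bool) (lam mu : Z -> R) : Prop :=
  let pi := piF lam mu in
  if isZ then
    unbounded (fun J => sumZ 1 (Z.of_nat J)
                 (fun j => / (lam j * pi j) * sumZ 1 j pi)) /\
    unbounded (fun J => sumZ 1 (Z.of_nat J)
                 (fun j => pi j * sumZ 1 (j - 1) (fun i => / (lam i * pi i)))) /\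
    unbounded (fun J => sumZ (- Z.of_nat J) (-1)
                 (fun j => / (lam j * pi j) * sumZ (j + 1) (-1) pi)) /\
    unbounded (fun J => sumZ (- Z.of_nat J) (-1)
                 (fun j => pi j * sumZ j (-1) (fun i => / (lam i * pi i))))
  else
    unbounded (fun J => sumZ 0 (Z.of_nat J)
                 (fun j => / (lam j * pi j) * sumZ 0 j pi)) /\
    (* sum_{j>=0} 1/(lam j pi j) * sum_{i>j} pi i = infinity (inner sum possibly infinite) *)
    (forall M : R, exists J K : nat,
        M < sumZ 0 (Z.of_nat J)
              (fun j => / (lam j * pi j) * sumZ (j + 1) (Z.of_nat K) pi)).

(* Birth-death chain on I with up-rate a x (x -> x+1) and down-rate b x (x -> x-1);
   jumps leaving I kill the chain (only relevant for the dual chain on N, killed at -1).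
   q is a solution of the Kolmogorov backward equations on I. *)
Definition backward_solution (isZ : bool) (a b : Z -> R) (q : R -> Z -> Z -> R) : Prop :=
  (forall t x y, 0 <= t -> inIb isZ x = true -> inIb isZ y = true -> 0 <= q t x y) /\
  (forall x y, inIb isZ x = true -> inIb isZ y = true ->
     q 0 x y = if Z.eq_dec x y then 1 else 0) /\
  (forall x y, inIb isZ x = true -> inIb isZ y = true ->
     forall eps, 0 < eps -> exists delta, 0 < delta /\
       forall s, 0 < s < delta -> Rabs (q s x y - q 0 x y) < eps) /\
  (forall t x y, 0 < t -> inIb isZ x = true -> inIb isZ y = true ->
     derivable_pt_lim (fun s => q s x y) t
       (- (a x + b x) * q t x y
        + (if inIb isZ (x + 1)%Z then a x * q t (x + 1)%Z y else 0)
        + (if inIb isZ (x - 1)%Z then b x * q t (x - 1)%Z y else 0))).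

(* The transition function of the (minimal) chain: the minimal nonnegative
   solution of the backward equations.  Under natural boundaries this is the
   unique (honest) transition function of the chain. *)
Definition transition_function (isZ : bool) (a b : Z -> R) (p : R -> Z -> Z -> R) : Prop :=
  backward_solution isZ a b p /\
  forall q, backward_solution isZ a b q ->
    forall t x y, 0 <= t -> inIb isZ x = true -> inIb isZ y = true -> p t x y <= q t x y.

Fixpoint det (n : nat) (M : nat -> nat -> R) : R :=
  match n with
  | O => 1
  | S m => fold_right Rplus 0
      (map (fun j => (-1) ^ j * M 0%nat j *
                     det m (fun i k => M (S i) (if Nat.ltb k j then k else S k)))
           (seq 0 (S m)))
  end.

Fixpoint incr (l : list Z) : bool :=
  match l with
  | a :: ((b :: _) as r) => (a <? b)%Z && incr r
  | _ => true
  end.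

Definition inW (isZ : bool) (n : nat) (x : list Z) : bool :=
  (length x =? n)%nat && forallb (inIb isZ) x && incr x.

Definition nthZ (i : nat) (x : list Z) : Z := nth i x 0%Z.

Definition in_Wnn1 (isZ : bool) (n : nat) (x y : list Z) : bool :=
  inW isZ n y &&
  forallb (fun i => (nthZ i x <=? nthZ i y)%Z && (nthZ i y <? nthZ (S i) x)%Z) (seq 0 n).

Definition in_Wnn (isZ : bool) (n : nat) (x y : list Z) : bool :=
  inW isZ n y &&
  forallb (fun i => (nthZ i y <=? nthZ i x)%Z) (seq 0 n) &&
  forallb (fun i => (nthZ i x <? nthZ (S i) y)%Z) (seq 0 (n - 1)).

Definition prodL (f : Z -> R) (y : list Z) : R := fold_right Rmult 1 (map f y).

Definition Lam_nn1 (isZ : bool) (lam mu : Z -> R) (n : nat) (x y : list Z) : R :=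
  if in_Wnn1 isZ n x y then prodL (pihat lam mu) y else 0.
Definition Lam_nn (isZ : bool) (lam mu : Z -> R) (n : nat) (x y : list Z) : R :=
  if in_Wnn isZ n x y then prodL (piF lam mu) y else 0.

Definition KM (p : R -> Z -> Z -> R) (t : R) (n : nat) (x y : list Z) : R :=
  det n (fun i j => p t (nthZ i x) (nthZ j y)).

Definition zrange (N : nat) : list Z :=
  map (fun k => (Z.of_nat k - Z.of_nat N)%Z) (seq 0 (2 * N + 1)).

Fixpoint box (m N : nat) : list (list Z) :=
  match m with
  | O => [[]]
  | S m' => flat_map (fun z => map (cons z) (box m' N)) (zrange N)
  end.

(* N-th truncation of (A B)(x,y) = sum_{z in W^m} A(x,z) B(z,y) *)
Definition kcomp_trunc (isZ : bool) (m : nat)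
    (A B : list Z -> list Z -> R) (x y : list Z) (N : nat) : R :=
  fold_right Rplus 0
    (map (fun z => if inW isZ m z then A x z * B z y else 0) (box m N)).

(* Main.v *)
(** Siegmund duality in one dimension, lifted by determinants.  If [H(y,x) = 1(y <= x)], the
    generators of a birth-death chain and of its dual satisfy [L_y H = Lhat_x H], whence
    [P_y(X_t <= x) = Phat_x(Xhat_t >= y)] for all [t].  Together with reversibility this writes
    each kernel as the other one's distribution function differenced in the starting point:
    [pihat(z) phat_t(z,y) = pihat(y) (P_z(X_t <= y) - P_{z+1}(X_t <= y))].  Summing a
    Karlin-McGregor determinant over an interlacing set is summing each column over an interval,
    so both sides of the intertwinings become determinants of distribution functions that differ
    by row and column operations only; the first one also needs that [p] is honest.

    The chains have unbounded rates.  They are approximated by chains with bounded rates, for which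
    the semigroup is an exponential series and all identities are algebraic.  Natural boundaries
    give, for the chain and for its dual, a function [h] tending to infinity with [L h] bounded,
    and the maximum principle against [h] yields at once the convergence of the approximations,
    uniqueness of bounded solutions of the backward equation, and honesty. *)

Require Import Defs.
From Stdlib Require Import Reals ZArith List Bool Arith.
From Stdlib Require Import Lia Lra FinFun FunctionalExtensionality.
From Coquelicot Require Import Coquelicot.
From mathcomp Require ssreflect ssrfun ssrbool eqtype ssrnat seq choice fintype bigop ssralg matrix.
From mathcomp Require Rstruct.
Open Scope R_scope.

(** * Maximum principle *)

(** Rates are set to zero outside [I], so every chain lives on all of [Z], the cemetery [-1] is an
    ordinary absorbing point, and one theory serves both state spaces and both chains. The obstacle
    is that each algebraic identity holds only for truncations suited to it: duality compares two
    exponential series term by term, with one uniformizing constant for both, and reversibility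
    survives only if both directions of an edge are cut together. Hence convergence is proved for
    arbitrary families of truncations, with a limit that does not depend on the family. Honesty
    enters because the last coordinate of an interlacing configuration is unbounded above: it
    produces a column of ones, which row differences reduce to a unit vector, and this brings the
    determinant from size [n + 1] down to [n]. *)

Definition gen (a b f : Z -> R) (x : Z) : R :=
  a x * (f (x + 1)%Z - f x) + b x * (f (x - 1)%Z - f x).

Definition rates (a b : Z -> R) : Prop := forall x, 0 <= a x /\ 0 <= b x.

Definition lyapunov (a b h : Z -> R) (C : R) : Prop :=
  0 <= C /\ (forall x, 0 <= h x) /\ (forall x, gen a b h x <= C) /\
  forall r, exists M, forall x, (M <= Z.abs x)%Z -> r <= h x.

(* A bounded solution of the backward equation satisfies this quadratic estimate, which, unlike
   differentiability, passes to pointwise limits and includes the time 0. *)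
Definition qsol_on (M : Z) (a b : Z -> R) (u : R -> Z -> R) : Prop :=
  exists K : Z -> R, forall x t s, (Z.abs x <= M)%Z -> 0 <= t -> 0 <= s ->
    Rabs (u (t + s) x - u t x - s * gen a b (u t) x) <= K x * s ^ 2.

Lemma bounded_on_interval (K : Z -> R) (M : Z) :
  exists B, 0 <= B /\ forall x, (Z.abs x <= M)%Z -> K x <= B.
Proof.
  assert (H : forall n : nat, exists B, 0 <= B /\
    forall x, (Z.abs x <= Z.of_nat n)%Z -> K x <= B).
  { induction n as [|n [B [HB H]]].
    - exists (Rabs (K 0%Z)); split; [apply Rabs_pos|].
      intros x Hx; replace x with 0%Z by lia; apply Rle_abs.
    - exists (B + Rabs (K (Z.of_nat (S n))) + Rabs (K (- Z.of_nat (S n))%Z)).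
      pose proof (Rabs_pos (K (Z.of_nat (S n)))) as H1.
      pose proof (Rabs_pos (K (- Z.of_nat (S n))%Z)) as H2.
      pose proof (Rle_abs (K (Z.of_nat (S n)))) as H3.
      pose proof (Rle_abs (K (- Z.of_nat (S n))%Z)) as H4.
      split; [lra|]. intros x Hx.
      destruct (Z.eq_dec x (Z.of_nat (S n))) as [->|N1]; [lra|].
      destruct (Z.eq_dec x (- Z.of_nat (S n))) as [->|N2]; [lra|].
      specialize (H x ltac:(lia)); lra. }
  destruct (H (Z.to_nat M)) as [B [HB HB']]; exists B; split; auto.
  intros x Hx; apply HB'; lia.
Qed.

(* The explicit Euler scheme with step [s <= 1 / max (a + b)] is monotone, so it
   preserves domination by the supersolution [B / m * (h + C t)]; its error
   [K s^2] per step disappears as the step tends to 0. *)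
Lemma max_principle (a b h : Z -> R) (C : R) (u : R -> Z -> R) (M : Z) (B m : R) :
  rates a b -> lyapunov a b h C -> qsol_on M a b u ->
  0 <= B -> (forall t x, 0 <= t -> u t x <= B) ->
  0 < m -> (forall x, Z.abs x = (M + 1)%Z -> m <= h x) ->
  (forall x, (Z.abs x <= M)%Z -> u 0 x <= 0) ->
  forall t x, 0 <= t -> (Z.abs x <= M)%Z -> u t x <= B / m * (h x + C * t).
Proof.
  intros Hab (HC & Hh & HL & _) [K0 HK0] HB HuB Hm Hhm Hu0.
  destruct (bounded_on_interval K0 M) as [K [HK HKb]].
  destruct (bounded_on_interval (fun x => a x + b x) M) as [r [Hr Hrb]].
  assert (HBm : 0 <= B / m) by (apply Rdiv_le_0_compat; lra).
  assert (Q : forall s, 0 <= s -> s * r <= 1 -> forall (k : nat) y, (Z.abs y <= M + 1)%Z ->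
    u (INR k * s) y <= B / m * (h y + C * (INR k * s)) + K * (INR k * s ^ 2)).
  { intros s Hs Hsr.
    (* At distance [M + 1] the barrier is at least [B], so the equation is only used inside. *)
    assert (Hbd : forall (k : nat) y, Z.abs y = (M + 1)%Z ->
      u (INR k * s) y <= B / m * (h y + C * (INR k * s)) + K * (INR k * s ^ 2)).
    { intros k y Hy. pose proof (pos_INR k) as Hk.
      assert (0 <= INR k * s) by (apply Rmult_le_pos; lra).
      assert (0 <= C * (INR k * s)) by (apply Rmult_le_pos; lra).
      assert (0 <= K * (INR k * s ^ 2)).
      { apply Rmult_le_pos; [lra|]. apply Rmult_le_pos; [lra|]. apply pow2_ge_0. }
      apply Rle_trans with B; [apply HuB; auto|].
      apply Rle_trans with (B / m * m); [right; field; lra|].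
      apply Rle_trans with (B / m * (h y + C * (INR k * s))); [|lra].
      apply Rmult_le_compat_l; [auto|]. specialize (Hhm y Hy); lra. }
    induction k as [|k IH]; intros y Hy.
    - destruct (Z.eq_dec (Z.abs y) (M + 1)) as [E|N]; [now apply Hbd|].
      simpl INR. rewrite !Rmult_0_l, Rmult_0_r, Rmult_0_r, !Rplus_0_r.
      apply Rle_trans with 0; [apply Hu0; lia|]. apply Rmult_le_pos; auto.
    - destruct (Z.eq_dec (Z.abs y) (M + 1)) as [E|N]; [now apply Hbd|].
      assert (Hy' : (Z.abs y <= M)%Z) by lia.
      pose proof (IH y Hy) as I0.
      pose proof (IH (y + 1)%Z ltac:(lia)) as I1.
      pose proof (IH (y - 1)%Z ltac:(lia)) as I2.
      destruct (Hab y) as [Ha Hb].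
      assert (Hks : 0 <= INR k * s) by (apply Rmult_le_pos; [apply pos_INR|lra]).
      pose proof (HK0 y (INR k * s) s Hy' Hks Hs) as HE.
      apply Rabs_le_between in HE. destruct HE as [_ HE].
      assert (HKs : K0 y * s ^ 2 <= K * s ^ 2)
        by (apply Rmult_le_compat_r; [apply pow2_ge_0|auto]).
      assert (Hstep : s * (a y + b y) <= 1).
      { apply Rle_trans with (s * r); [|lra]. apply Rmult_le_compat_l; auto. }
      rewrite S_INR, Rmult_plus_distr_r, Rmult_1_l.
      pose proof (HL y) as HLy. unfold gen in HE, HLy.
      set (W := fun z => B / m * (h z + C * (INR k * s)) + K * (INR k * s ^ 2)) in *.
      assert (J0 : (1 - s * (a y + b y)) * u (INR k * s) y <= (1 - s * (a y + b y)) * W y)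
        by (apply Rmult_le_compat_l; [lra|exact I0]).
      assert (J1 : s * a y * u (INR k * s) (y + 1)%Z <= s * a y * W (y + 1)%Z)
        by (apply Rmult_le_compat_l; [now apply Rmult_le_pos|exact I1]).
      assert (J2 : s * b y * u (INR k * s) (y - 1)%Z <= s * b y * W (y - 1)%Z)
        by (apply Rmult_le_compat_l; [now apply Rmult_le_pos|exact I2]).
      assert (J3 : B / m * (s * (a y * (h (y + 1)%Z - h y) + b y * (h (y - 1)%Z - h y)))
                   <= B / m * (s * C))
        by (apply Rmult_le_compat_l; [auto|]; apply Rmult_le_compat_l; auto).
      assert (J4 : (1 - s * (a y + b y)) * W y + s * a y * W (y + 1)%Z + s * b y * W (y - 1)%Z
        = W y + B / m * (s * (a y * (h (y + 1)%Z - h y) + b y * (h (y - 1)%Z - h y))))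
        by (unfold W; ring).
      assert (J5 : B / m * (h y + C * (INR k * s + s)) + K * ((INR k + 1) * s ^ 2)
        = W y + B / m * (s * C) + K * s ^ 2) by (unfold W; ring).
      rewrite J5. lra. }
  intros t x Ht Hx. apply le_epsilon. intros eps Heps.
  (* With [k] steps of length [t / k], [t r <= k] makes the scheme monotone and [K t^2 / eps <= k]
     keeps the accumulated error [K k (t / k)^2] below [eps]. *)
  destruct (INR_unbounded (Rmax 1 (Rmax (t * r) (K * t ^ 2 / eps)))) as [k Hk].
  pose proof (Rmax_l 1 (Rmax (t * r) (K * t ^ 2 / eps))).
  pose proof (Rmax_r 1 (Rmax (t * r) (K * t ^ 2 / eps))).
  pose proof (Rmax_l (t * r) (K * t ^ 2 / eps)).
  pose proof (Rmax_r (t * r) (K * t ^ 2 / eps)).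
  assert (Hk0 : 0 < INR k) by lra.
  specialize (Q (t / INR k)).
  assert (Hs : 0 <= t / INR k) by (apply Rdiv_le_0_compat; lra).
  assert (Hsr : t / INR k * r <= 1).
  { apply (Rmult_le_reg_r (INR k)); [auto|].
    replace (t / INR k * r * INR k) with (t * r) by (field; lra). lra. }
  specialize (Q Hs Hsr k x ltac:(lia)).
  replace (INR k * (t / INR k)) with t in Q by (field; lra).
  apply Rle_trans with (1 := Q). apply Rplus_le_compat_l.
  replace (K * (INR k * (t / INR k) ^ 2)) with (K * t ^ 2 / INR k) by (field; lra).
  apply (Rmult_le_reg_r (INR k)); [auto|].
  replace (K * t ^ 2 / INR k * INR k) with (K * t ^ 2) by (field; lra).
  apply Rle_trans with (eps * (K * t ^ 2 / eps)); [right; field; lra|].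
  apply Rmult_le_compat_l; lra.
Qed.

Lemma gen_lin (a b f g : Z -> R) (c d : R) (x : Z) :
  gen a b (fun z => c * f z + d * g z) x = c * gen a b f x + d * gen a b g x.
Proof. unfold gen; ring. Qed.

Lemma qsol_on_lin (M : Z) (a b : Z -> R) (u v : R -> Z -> R) (c d : R) :
  qsol_on M a b u -> qsol_on M a b v ->
  qsol_on M a b (fun t x => c * u t x + d * v t x).
Proof.
  intros [K HK] [K' HK']. exists (fun x => Rabs c * K x + Rabs d * K' x).
  intros x t s Hx Ht Hs. rewrite gen_lin.
  replace (_ - _ - _) with
    (c * (u (t + s) x - u t x - s * gen a b (u t) x) +
     d * (v (t + s) x - v t x - s * gen a b (v t) x)) by ring.
  eapply Rle_trans; [apply Rabs_triang|]. rewrite !Rabs_mult, Rmult_plus_distr_r.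
  rewrite !Rmult_assoc.
  apply Rplus_le_compat; apply Rmult_le_compat_l; auto using Rabs_pos.
Qed.

Lemma qsol_on_local (M : Z) (a b a' b' : Z -> R) (u : R -> Z -> R) :
  (forall x, (Z.abs x <= M)%Z -> a x = a' x /\ b x = b' x) ->
  qsol_on M a b u -> qsol_on M a' b' u.
Proof.
  intros H [K HK]; exists K; intros x t s Hx Ht Hs.
  specialize (HK x t s Hx Ht Hs). destruct (H x Hx) as [E1 E2].
  unfold gen in *. now rewrite <- E1, <- E2.
Qed.

(** [M0] is chosen before [u], since the barrier at [(t, x)] depends on [u] only through the bound
    [B]. This uniformity lets one estimate give Cauchy sequences, continuity in the data and
    uniqueness. *)
Lemma solution_small (a b h : Z -> R) (C B t eps : R) (x : Z) :
  rates a b -> lyapunov a b h C -> 0 <= B -> 0 <= t -> 0 < eps ->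
  exists M0 : nat, forall (M : nat) u, (M0 <= M)%nat -> qsol_on (Z.of_nat M) a b u ->
    (forall s y, 0 <= s -> Rabs (u s y) <= B) ->
    (forall y, (Z.abs y <= Z.of_nat M)%Z -> u 0 y = 0) ->
    Rabs (u t x) <= eps.
Proof.
  intros Hab HL HB Ht Heps. destruct (HL) as (HC & Hh & _ & Hinf).
  (* The level of [h] on the boundary for which the barrier [B / m * (h x + C t)] is at most [eps];
     the 1 keeps it positive. *)
  set (m := Rmax 1 (B * (h x + C * t) / eps)).
  destruct (Hinf m) as [M1 HM1].
  exists (Z.to_nat (Z.max M1 (Z.abs x))).
  intros M u HM Hu HuB Hu0.
  assert (Hm : 0 < m) by (pose proof (Rmax_l 1 (B * (h x + C * t) / eps)); unfold m; lra).
  assert (Hle : B / m * (h x + C * t) <= eps).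
  { apply (Rmult_le_reg_r m); [auto|].
    replace (B / m * (h x + C * t) * m) with (B * (h x + C * t)) by (field; lra).
    apply Rle_trans with (eps * (B * (h x + C * t) / eps)); [right; field; lra|].
    apply Rmult_le_compat_l; [lra|]. apply Rmax_r. }
  assert (Hbd : forall y, Z.abs y = (Z.of_nat M + 1)%Z -> m <= h y)
    by (intros y Hy; apply HM1; lia).
  apply Rabs_le. split.
  - enough (-1 * u t x + 0 * u t x <= eps) by lra.
    apply Rle_trans with (2 := Hle).
    apply (max_principle a b h C (fun s y => -1 * u s y + 0 * u s y) (Z.of_nat M));
      auto using qsol_on_lin; try lia.
    + intros s y Hs. specialize (HuB s y Hs). apply Rabs_le_between in HuB. lra.
    + intros y Hy. rewrite Hu0; auto; lra.
  - apply Rle_trans with (2 := Hle).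
    apply (max_principle a b h C u (Z.of_nat M)); auto; try lia.
    + intros s y Hs. specialize (HuB s y Hs). apply Rabs_le_between in HuB. lra.
    + intros y Hy. rewrite Hu0; auto; lra.
Qed.

(** * Chains with bounded rates *)

(* [curv a b x * B] bounds the second time derivative at [x] of solutions bounded by [B]. *)
Definition curv (a b : Z -> R) (x : Z) : R :=
  2 * (a x + b x) * (a (x - 1)%Z + b (x - 1)%Z + (a x + b x) + (a (x + 1)%Z + b (x + 1)%Z)).

Lemma gen_bound (a b f : Z -> R) (B : R) (x : Z) :
  rates a b -> (forall y, Rabs (f y) <= B) -> Rabs (gen a b f x) <= 2 * B * (a x + b x).
Proof.
  intros Hab Hf. destruct (Hab x) as [Ha Hb]. unfold gen.
  pose proof (Hf x) as H0. pose proof (Hf (x + 1)%Z) as H1. pose proof (Hf (x - 1)%Z) as H2.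
  apply Rabs_le_between in H0, H1, H2. apply Rabs_le. split; nra.
Qed.

(** * Quadratic time estimates for bounded solutions *)

Section Taylor.
Variables (a b al be : Z -> R) (u : R -> Z -> R) (B : R).
Hypothesis Hrates : rates al be.
Hypothesis Hle : forall x, al x <= a x /\ be x <= b x.
Hypothesis HB : forall t x, 0 <= t -> Rabs (u t x) <= B.
Hypothesis Hder : forall t x, 0 < t ->
  derivable_pt_lim (fun s => u s x) t (gen al be (u t) x).

Lemma solution_lipschitz (t s : R) (x : Z) : 0 < t -> 0 <= s ->
  Rabs (u (t + s) x - u t x) <= 2 * B * (a x + b x) * s.
Proof.
  intros Ht Hs. assert (B0 : 0 <= B).
  { eapply Rle_trans; [apply Rabs_pos|apply (HB t x); lra]. }
  destruct (Req_dec s 0) as [->|Hs0].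
  { rewrite Rplus_0_r, Rminus_diag, Rabs_R0. lra. }
  destruct (MVT_cor2 (fun r => u r x) (fun r => gen al be (u r) x) t (t + s)) as [c [E Hc]].
  - lra.
  - intros c Hc. apply Hder. lra.
  - rewrite E. rewrite Rabs_mult. rewrite (Rabs_right (t + s - t)) by lra.
    replace (t + s - t) with s by ring. apply Rmult_le_compat_r; [lra|].
    apply Rle_trans with (2 * B * (al x + be x)).
    + apply gen_bound; auto. intros y; apply HB; lra.
    + apply Rmult_le_compat_l; [lra|]. specialize (Hle x); lra.
Qed.

(** The increment is [s] times the generator at an intermediate time, and the Lipschitz bound
    controls how far the generator moves meanwhile. The constant uses the dominating rates [a], [b]
    in place of [al], [be], so all truncations of a chain share it and it survives their limit. *)
Lemma solution_taylor_pos (t s : R) (x : Z) : 0 < t -> 0 <= s ->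
  Rabs (u (t + s) x - u t x - s * gen al be (u t) x) <= curv a b x * B * s ^ 2.
Proof.
  intros Ht Hs. assert (B0 : 0 <= B).
  { eapply Rle_trans; [apply Rabs_pos|apply (HB t x); lra]. }
  destruct (Req_dec s 0) as [->|Hs0].
  { rewrite Rplus_0_r, Rminus_diag. replace (0 - _) with 0 by ring. rewrite Rabs_R0. lra. }
  destruct (MVT_cor2 (fun r => u r x) (fun r => gen al be (u r) x) t (t + s)) as [c [E Hc]].
  - lra.
  - intros c Hc. apply Hder. lra.
  - rewrite E. replace (t + s - t) with s by ring.
    replace (gen al be (u c) x * s - s * gen al be (u t) x)
      with (gen al be (fun y => u c y - u t y) x * s) by (unfold gen; ring).
    rewrite Rabs_mult, (Rabs_right s) by lra.
    replace (curv a b x * B * s ^ 2) with (curv a b x * B * s * s) by ring.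
    apply Rmult_le_compat_r; [lra|].
    assert (HD : forall y, Rabs (u c y - u t y) <= 2 * B * (a y + b y) * s).
    { intros y. replace c with (t + (c - t)) by ring.
      eapply Rle_trans; [apply solution_lipschitz; lra|].
      destruct (Hle y), (Hrates y).
      apply Rmult_le_compat_l; [|lra].
      apply Rmult_le_pos; lra. }
    pose proof (HD x) as D0. pose proof (HD (x + 1)%Z) as D1.
    pose proof (HD (x - 1)%Z) as D2.
    destruct (Hle x), (Hrates x).
    destruct (Hle (x + 1)%Z), (Hrates (x + 1)%Z).
    destruct (Hle (x - 1)%Z), (Hrates (x - 1)%Z).
    unfold gen, curv. set (D := fun y => u c y - u t y) in *.
    fold (D x) in *. fold (D (x + 1)%Z) in *. fold (D (x - 1)%Z) in *.
    assert (Bs : 0 <= 2 * B * s) by (apply Rmult_le_pos; lra).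
    set (S := a (x - 1)%Z + b (x - 1)%Z + (a x + b x) + (a (x + 1)%Z + b (x + 1)%Z)).
    assert (T1 : Rabs (D (x + 1)%Z - D x) <= 2 * B * s * S).
    { eapply Rle_trans; [apply Rabs_triang|]. rewrite Rabs_Ropp.
      apply Rle_trans with (2 * B * s * ((a x + b x) + (a (x + 1)%Z + b (x + 1)%Z))).
      - lra.
      - apply Rmult_le_compat_l; auto. unfold S; lra. }
    assert (T2 : Rabs (D (x - 1)%Z - D x) <= 2 * B * s * S).
    { eapply Rle_trans; [apply Rabs_triang|]. rewrite Rabs_Ropp.
      apply Rle_trans with (2 * B * s * ((a x + b x) + (a (x - 1)%Z + b (x - 1)%Z))).
      - lra.
      - apply Rmult_le_compat_l; auto. unfold S; lra. }
    eapply Rle_trans; [apply Rabs_triang|]. rewrite !Rabs_mult.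
    rewrite (Rabs_right (al x)), (Rabs_right (be x)) by lra.
    replace (2 * (a x + b x) * S * B * s)
      with (a x * (2 * B * s * S) + b x * (2 * B * s * S)) by ring.
    apply Rplus_le_compat; apply Rmult_le_compat; auto using Rabs_pos.
Qed.

Hypothesis Hcont : forall x eps, 0 < eps -> exists delta, 0 < delta /\
  forall s, 0 < s < delta -> Rabs (u s x - u 0 x) < eps.

(** The derivative is given for positive times only; right continuity at 0 carries the estimate
    along the times [tau k = 1 / (k + 1)] to [t = 0]. *)
Lemma solution_taylor (t s : R) (x : Z) : 0 <= t -> 0 <= s ->
  Rabs (u (t + s) x - u t x - s * gen al be (u t) x) <= curv a b x * B * s ^ 2.
Proof.
  intros Ht Hs. destruct (Rle_lt_or_eq_dec 0 t Ht) as [Ht'|<-].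
  { now apply solution_taylor_pos. }
  destruct (Req_dec s 0) as [->|Hs0].
  { rewrite Rplus_0_r, Rminus_diag. replace (0 - _) with 0 by ring. rewrite Rabs_R0. lra. }
  rewrite Rplus_0_l.
  set (tau := fun k : nat => / (INR k + 1)).
  assert (Htau : forall k, 0 < tau k).
  { intros k. apply Rinv_0_lt_compat. pose proof (pos_INR k); lra. }
  assert (Ltau : is_lim_seq tau 0).
  { apply is_lim_seq_ext with (fun k => / INR (S k)).
    - intros k; unfold tau. now rewrite S_INR.
    - apply is_lim_seq_incr_1 with (u := fun k => / INR k).
      replace (Finite 0) with (Rbar_inv p_infty) by reflexivity.
      apply is_lim_seq_inv; [apply is_lim_seq_INR|discriminate]. }
  assert (L0 : forall y, is_lim_seq (fun k => u (tau k) y) (u 0 y)).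
  { intros y. apply is_lim_seq_spec. intros [e He]. simpl.
    destruct (Hcont y e He) as [d [Hd Hd']].
    apply is_lim_seq_spec in Ltau. destruct (Ltau (mkposreal d Hd)) as [k0 Hk0].
    exists k0. intros k Hk. apply Hd'. split; [apply Htau|].
    specialize (Hk0 k Hk). simpl in Hk0. rewrite Rminus_0_r in Hk0.
    apply Rabs_lt_between in Hk0. lra. }
  assert (Ls : is_lim_seq (fun k => u (tau k + s) x) (u s x)).
  { apply (is_lim_seq_continuous (fun r => u r x)).
    - apply derivable_continuous_pt. exists (gen al be (u s) x). apply Hder. lra.
    - replace (Finite s) with (Finite (0 + s)) by (f_equal; ring).
      apply is_lim_seq_plus'; [auto|apply is_lim_seq_const]. }
  assert (Lg : is_lim_seq (fun k => gen al be (u (tau k)) x) (gen al be (u 0) x)).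
  { unfold gen. apply is_lim_seq_plus'; apply is_lim_seq_mult';
      try apply is_lim_seq_const; apply is_lim_seq_minus'; auto. }
  assert (LL : is_lim_seq
    (fun k => Rabs (u (tau k + s) x - u (tau k) x - s * gen al be (u (tau k)) x))
    (Rabs (u s x - u 0 x - s * gen al be (u 0) x))).
  { apply (is_lim_seq_abs _ (Finite _)). apply is_lim_seq_minus'; [now apply is_lim_seq_minus'|].
    apply is_lim_seq_mult'; [apply is_lim_seq_const|auto]. }
  assert (Hfin := is_lim_seq_le _ _ _ _ (fun k => solution_taylor_pos (tau k) s x (Htau k) Hs)
    LL (is_lim_seq_const _)).
  exact Hfin.
Qed.

End Taylor.

(** * Uniformization *)

Definition step (a b : Z -> R) (c : R) (f : Z -> R) (x : Z) : R := c * f x + gen a b f x.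

Definition powstep (a b : Z -> R) (c : R) (k : nat) (f : Z -> R) : Z -> R :=
  Nat.iter k (step a b c) f.

Definition bounded_rates (a b : Z -> R) (c : R) : Prop :=
  rates a b /\ forall x, a x + b x <= c.

(* Uniformization: [exp (t L) = exp (- c t) exp (t (c + L))], where [c + L] is nonnegative. *)
Definition expo (a b : Z -> R) (c t : R) (f : Z -> R) (x : Z) : R :=
  exp (- (c * t)) * PSeries (fun k => powstep a b c k f x / INR (fact k)) t.

(** [c + L] combines the values at [x], [x + 1], [x - 1] with weights [c - (a x + b x)], [a x],
    [b x], which are nonnegative with sum [c]. The norm is thus at most [c], and the factor
    [exp (- c t)] cancels the growth of the series. *)
Lemma step_bound (a b : Z -> R) (c B : R) (f : Z -> R) (x : Z) :
  bounded_rates a b c -> (forall y, Rabs (f y) <= B) -> Rabs (step a b c f x) <= c * B.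
Proof.
  intros [Hr Hc] Hf. destruct (Hr x) as [Ha Hb]. specialize (Hc x).
  pose proof (Hf x) as H0. pose proof (Hf (x + 1)%Z) as H1. pose proof (Hf (x - 1)%Z) as H2.
  apply Rabs_le_between in H0, H1, H2. unfold step, gen.
  replace (c * f x + (a x * (f (x + 1)%Z - f x) + b x * (f (x - 1)%Z - f x)))
    with ((c - (a x + b x)) * f x + a x * f (x + 1)%Z + b x * f (x - 1)%Z) by ring.
  assert (P : forall r z, 0 <= r -> -B <= z <= B -> - (r * B) <= r * z <= r * B).
  { intros r z Hr' Hz. split; [rewrite <- Ropp_mult_distr_r_reverse|];
      apply Rmult_le_compat_l; lra. }
  assert (Hd : 0 <= c - (a x + b x)) by lra. pose proof (P _ _ Hd H0).
  pose proof (P _ _ Ha H1). pose proof (P _ _ Hb H2). apply Rabs_le. lra.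
Qed.

Lemma powstep_bound (a b : Z -> R) (c B : R) (f : Z -> R) (k : nat) (x : Z) :
  bounded_rates a b c -> (forall y, Rabs (f y) <= B) ->
  Rabs (powstep a b c k f x) <= c ^ k * B.
Proof.
  intros H Hf. revert x. induction k as [|k IH]; intros x; simpl.
  - rewrite Rmult_1_l. apply Hf.
  - rewrite Rmult_assoc. now apply step_bound.
Qed.

Lemma bounded_rates_nonneg (a b : Z -> R) (c : R) : bounded_rates a b c -> 0 <= c.
Proof. intros [Hr Hc]. destruct (Hr 0%Z). specialize (Hc 0%Z). lra. Qed.

Lemma pow_fact_le_exp (x : R) (k : nat) : 0 <= x -> x ^ k / INR (fact k) <= exp x.
Proof.
  intros Hx. apply Rle_trans with (2 := exp_ge_taylor x k Hx).
  assert (P : forall j, 0 <= x ^ j / INR (fact j)).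
  { intros j. apply Rdiv_le_0_compat; [now apply pow_le|apply INR_fact_lt_0]. }
  destruct k as [|k]; [apply Rle_refl|]. rewrite tech5.
  pose proof (cond_pos_sum _ k P). lra.
Qed.

Section Expo.
Variables (a b : Z -> R) (c B : R) (f : Z -> R).
Hypothesis Hbr : bounded_rates a b c.
Hypothesis Hf : forall y, Rabs (f y) <= B.

Let coef (x : Z) (k : nat) : R := powstep a b c k f x / INR (fact k).

Lemma expo_term (x : Z) (k : nat) (r : R) :
  Rabs (coef x k * r ^ k) <= B * ((c * Rabs r) ^ k / INR (fact k)).
Proof.
  unfold coef. rewrite Rabs_mult, <- RPow_abs. unfold Rdiv at 1.
  rewrite Rabs_mult, (Rabs_right (/ INR (fact k)));
    [|apply Rle_ge, Rlt_le, Rinv_0_lt_compat, INR_fact_lt_0].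
  rewrite Rpow_mult_distr. unfold Rdiv.
  replace (B * (c ^ k * Rabs r ^ k * / INR (fact k)))
    with (c ^ k * B * (/ INR (fact k)) * Rabs r ^ k) by ring.
  apply Rmult_le_compat_r; [apply pow_le, Rabs_pos|].
  apply Rmult_le_compat_r; [apply Rlt_le, Rinv_0_lt_compat, INR_fact_lt_0|].
  now apply powstep_bound.
Qed.

Lemma expo_radius (x : Z) (r : R) : Rbar_lt (Rabs r) (CV_radius (coef x)).
Proof.
  assert (B0 : 0 <= B) by (eapply Rle_trans; [apply Rabs_pos|apply (Hf 0%Z)]).
  (* Boundedness of the terms at a point yields only a weak inequality for the radius, hence the
     larger point [|r| + 1]. *)
  apply Rbar_lt_le_trans with (Finite (Rabs r + 1)); [simpl; lra|].
  apply (proj1 (CV_radius_bounded (coef x))).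
  exists (B * exp (c * Rabs (Rabs r + 1))). intros k.
  eapply Rle_trans; [apply expo_term|]. apply Rmult_le_compat_l; [auto|].
  apply pow_fact_le_exp. apply Rmult_le_pos; [eapply bounded_rates_nonneg; eauto|apply Rabs_pos].
Qed.

Lemma expo_ex (x : Z) (r : R) : ex_pseries (coef x) r.
Proof. apply CV_radius_inside, expo_radius. Qed.

Lemma exp_series (z : R) : is_series (fun k => z ^ k / INR (fact k)) (exp z).
Proof.
  apply is_series_ext with (2 := is_exp_Reals z). intros k.
  unfold scal; simpl; unfold mult; simpl. rewrite pow_n_pow. unfold Rdiv; reflexivity.
Qed.

Lemma expo_bound (t : R) (x : Z) : 0 <= t -> Rabs (expo a b c t f x) <= B.
Proof.
  intros Ht. pose proof (bounded_rates_nonneg _ _ _ Hbr) as Hc.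
  unfold expo. rewrite Rabs_mult, (Rabs_right (exp _)); [|apply Rle_ge, Rlt_le, exp_pos].
  fold (coef x).
  assert (E : is_series (fun k => B * ((c * Rabs t) ^ k / INR (fact k))) (B * exp (c * Rabs t))).
  { apply (is_series_scal (K := R_AbsRing) (V := R_NormedModule) B), exp_series. }
  assert (H : Rabs (PSeries (coef x) t) <= B * exp (c * t)).
  { unfold PSeries. replace (c * t) with (c * Rabs t) by (rewrite Rabs_right; lra).
    rewrite <- (is_series_unique _ _ E).
    assert (E2 : ex_series (fun k => Rabs (coef x k * t ^ k))).
    { apply (@ex_series_le R_AbsRing R_CompleteNormedModule)
        with (fun k => B * ((c * Rabs t) ^ k / INR (fact k))).
      - intros k. unfold norm; simpl. unfold abs; simpl. rewrite Rabs_Rabsolu.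
        apply expo_term.
      - eexists; exact E. }
    eapply Rle_trans; [now apply Series_Rabs|].
    apply Series_le; [|eexists; exact E].
    intros k; split; [apply Rabs_pos|apply expo_term]. }
  apply Rle_trans with (exp (- (c * t)) * (B * exp (c * t))).
  - apply Rmult_le_compat_l; [apply Rlt_le, exp_pos|auto].
  - rewrite exp_Ropp. right. field. apply Rgt_not_eq, exp_pos.
Qed.

Lemma expo_derive (t : R) (x : Z) :
  is_derive (fun s => expo a b c s f x) t (gen a b (expo a b c t f) x).
Proof.
  assert (HD : is_derive (PSeries (coef x)) t
    (c * PSeries (coef x) t + gen a b (fun y => PSeries (coef y) t) x)).
  { replace (c * PSeries (coef x) t + gen a b (fun y => PSeries (coef y) t) x)
      with (PSeries (PS_derive (coef x)) t).
    { apply is_derive_PSeries, expo_radius. }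
    (* The derived series has coefficients [step (powstep k f) x / k!], here split into the
       contributions of [x], [x + 1] and [x - 1], so that it is a combination of the series at three
       points. *)
    rewrite (PSeries_ext (PS_derive (coef x))
      (PS_plus (PS_scal (c - a x - b x) (coef x))
         (PS_plus (PS_scal (a x) (coef (x + 1)%Z)) (PS_scal (b x) (coef (x - 1)%Z))))).
    - assert (Hs : forall (d : R) y, ex_pseries (PS_scal d (coef y)) t).
      { intros d y. apply ex_pseries_scal; [apply Rmult_comm|apply expo_ex]. }
      rewrite !PSeries_plus; auto; [|apply ex_pseries_plus; auto].
      rewrite !PSeries_scal. unfold gen. ring.
    - intros k. unfold PS_derive, PS_plus, PS_scal, coef, plus, scal; simpl; unfold mult; simpl.
      change (match k with 0%nat => 1 | S _ => INR k + 1 end) with (INR (S k)).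
      rewrite plus_INR, mult_INR, S_INR.
      change (powstep a b c (S k) f x) with (step a b c (powstep a b c k f) x).
      change (Nat.iter k (step a b c) f) with (powstep a b c k f).
      unfold step, gen. pose proof (INR_fact_neq_0 k). pose proof (pos_INR k). field.
      split; [auto|].
      replace (INR (fact k) + INR k * INR (fact k)) with ((1 + INR k) * INR (fact k)) by ring.
      apply Rmult_integral_contrapositive_currified; [lra|auto]. }
  unfold expo. fold (coef x).
  replace (gen a b _ x) with
    (- c * exp (- (c * t)) * PSeries (coef x) t
     + exp (- (c * t)) * (c * PSeries (coef x) t + gen a b (fun y => PSeries (coef y) t) x)).
  2:{ unfold gen. fold (coef x) (coef (x+1)%Z) (coef (x-1)%Z). ring. }
  apply (is_derive_mult (fun s => exp (- (c * s)))); auto; [|apply Rmult_comm].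
  auto_derive; [auto|ring].
Qed.

Lemma expo_0 (x : Z) : expo a b c 0 f x = f x.
Proof.
  unfold expo. rewrite Rmult_0_r, Ropp_0, exp_0, PSeries_0. simpl. field.
Qed.

Lemma expo_taylor (a' b' : Z -> R) (t s : R) (x : Z) :
  (forall x, a x <= a' x /\ b x <= b' x) -> 0 <= t -> 0 <= s ->
  Rabs (expo a b c (t + s) f x - expo a b c t f x - s * gen a b (expo a b c t f) x)
    <= curv a' b' x * B * s ^ 2.
Proof.
  intros Hle Ht Hs.
  apply (solution_taylor a' b' a b (fun t => expo a b c t f) B); auto.
  - apply Hbr.
  - intros; now apply expo_bound.
  - intros r y _. apply is_derive_Reals, expo_derive.
  - intros y eps Heps.
    assert (Hc : continuity_pt (fun s => expo a b c s f y) 0).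
    { apply derivable_continuous_pt. exists (gen a b (expo a b c 0 f) y).
      apply is_derive_Reals, expo_derive. }
    destruct (Hc eps Heps) as [d [Hd Hd']]. exists d; split; [auto|].
    intros r Hr. apply Hd'. split.
    + split; [exact I|lra].
    + unfold dist; simpl; unfold Rdist. rewrite Rminus_0_r, Rabs_right; lra.
Qed.

End Expo.

(** * The semigroup of a non-explosive chain *)

Definition sumL {A : Type} (l : list A) (f : A -> R) : R := fold_right Rplus 0 (map f l).

Lemma sumL_nonneg {A : Type} (l : list A) (f : A -> R) :
  (forall x, 0 <= f x) -> 0 <= sumL l f.
Proof.
  intros Hf. unfold sumL. induction l as [|y l IH]; simpl; [lra|]. specialize (Hf y). lra.
Qed.

Lemma sumL_ge_term {A : Type} (l : list A) (f : A -> R) (x : A) :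
  (forall y, 0 <= f y) -> In x l -> f x <= sumL l f.
Proof.
  intros Hf. induction l as [|y l IH]; simpl; [tauto|]. unfold sumL in *; simpl.
  pose proof (sumL_nonneg l f Hf) as H; unfold sumL in H. pose proof (Hf y).
  intros [->|Hx]; [lra|]. specialize (IH Hx). lra.
Qed.

Lemma in_zrange (N : nat) (x : Z) : In x (zrange N) <-> (Z.abs x <= Z.of_nat N)%Z.
Proof.
  unfold zrange. rewrite in_map_iff. split.
  - intros [k [<- Hk]]. apply in_seq in Hk. lia.
  - intros H. exists (Z.to_nat (x + Z.of_nat N)). split; [lia|]. apply in_seq. lia.
Qed.

Definition trunc (N : nat) (a : Z -> R) (x : Z) : R :=
  if (Z.abs x <=? Z.of_nat N)%Z then a x else 0.

Definition maxrate (a b : Z -> R) (N : nat) : R := sumL (zrange N) (fun x => a x + b x).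

(** [Lim_seq] and [real] are total; [semi_lim] shows that the limit is genuine for bounded [f] and
    [0 <= t] in the presence of a Lyapunov function. *)
Definition semi (a b : Z -> R) (t : R) (f : Z -> R) (x : Z) : R :=
  real (Lim_seq (fun N => expo (trunc N a) (trunc N b) (maxrate a b N) t f x)).

(** Domination gives a common Taylor constant, and agreement on the window makes the truncated
    semigroup solve the original equation there. The shape of the cut stays free, so that it can be
    adapted to the identity at hand. *)
Definition approx (a b : Z -> R) (al be : nat -> Z -> R) (c : nat -> R) : Prop :=
  forall N, bounded_rates (al N) (be N) (c N) /\
    (forall x, al N x <= a x /\ be N x <= b x) /\
    forall x, (Z.abs x <= Z.of_nat N)%Z -> al N x = a x /\ be N x = b x.

Lemma maxrate_ge (a b : Z -> R) (N : nat) (x : Z) :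
  rates a b -> (Z.abs x <= Z.of_nat N)%Z -> a x + b x <= maxrate a b N.
Proof.
  intros H Hx. apply (sumL_ge_term (zrange N) (fun x => a x + b x)).
  - intros y; destruct (H y); lra.
  - now apply in_zrange.
Qed.

Lemma maxrate_nonneg (a b : Z -> R) (N : nat) : rates a b -> 0 <= maxrate a b N.
Proof. intros H. apply sumL_nonneg. intros y; destruct (H y); lra. Qed.

Lemma approx_trunc (a b : Z -> R) :
  rates a b -> approx a b (fun N => trunc N a) (fun N => trunc N b) (maxrate a b).
Proof.
  intros H N. unfold trunc. split; [split|split].
  - intros x. destruct (H x). destruct (Z.abs x <=? Z.of_nat N)%Z; lra.
  - intros x. destruct (Z.leb_spec (Z.abs x) (Z.of_nat N)); [now apply maxrate_ge|].
    rewrite Rplus_0_l. now apply maxrate_nonneg.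
  - intros x. destruct (H x). destruct (Z.abs x <=? Z.of_nat N)%Z; lra.
  - intros x Hx. apply Z.leb_le in Hx. now rewrite Hx.
Qed.

Lemma qsol_on_mono (M M' : Z) (a b : Z -> R) (u : R -> Z -> R) :
  (M <= M')%Z -> qsol_on M' a b u -> qsol_on M a b u.
Proof.
  intros H [K HK]. exists K. intros x t s Hx. apply HK. lia.
Qed.

Lemma expo_qsol (a b : Z -> R) al be c (N : nat) (f : Z -> R) (B : R) :
  approx a b al be c -> (forall y, Rabs (f y) <= B) ->
  qsol_on (Z.of_nat N) a b (fun t => expo (al N) (be N) (c N) t f).
Proof.
  intros H Hf. destruct (H N) as [Hb [Hl He]].
  apply qsol_on_local with (al N) (be N); [auto|].
  exists (fun x => curv a b x * B). intros x t s _ Ht Hs. now apply expo_taylor.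
Qed.

Section Semigroup.
Variables (a b h : Z -> R) (C : R).
Hypothesis Hab : rates a b.
Hypothesis HL : lyapunov a b h C.

(** The difference of two approximations starts at 0, is bounded by [2 B] and solves the original
    equation on the smaller window. Taking one family twice gives existence of the limit, two
    families its independence of the family. *)
Lemma expo_cauchy al be c al' be' c' (f : Z -> R) (B t eps : R) (x : Z) :
  approx a b al be c -> approx a b al' be' c' -> (forall y, Rabs (f y) <= B) ->
  0 <= t -> 0 < eps ->
  exists M0 : nat, forall N N', (M0 <= N)%nat -> (M0 <= N')%nat ->
    Rabs (expo (al N) (be N) (c N) t f x - expo (al' N') (be' N') (c' N') t f x) <= eps.
Proof.
  intros H H' Hf Ht Heps.
  assert (B0 : 0 <= B) by (eapply Rle_trans; [apply Rabs_pos|apply (Hf 0%Z)]).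
  destruct (solution_small a b h C (B + B) t eps x) as [M0 HM0]; auto; [lra|].
  exists M0. intros N N' HN HN'.
  replace (_ - _) with (1 * expo (al N) (be N) (c N) t f x
    + -1 * expo (al' N') (be' N') (c' N') t f x) by ring.
  apply (HM0 (Nat.min N N') (fun s y => 1 * expo (al N) (be N) (c N) s f y
    + -1 * expo (al' N') (be' N') (c' N') s f y)); [lia| | |].
  - apply qsol_on_lin.
    + apply qsol_on_mono with (Z.of_nat N); [lia|]. eapply expo_qsol; eauto.
    + apply qsol_on_mono with (Z.of_nat N'); [lia|].
      now apply (expo_qsol a b al' be' c' N' f B).
  - intros s y Hs. replace (_ + _) with (expo (al N) (be N) (c N) s f y
      - expo (al' N') (be' N') (c' N') s f y) by ring.
    eapply Rle_trans; [apply Rabs_triang|]. rewrite Rabs_Ropp.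
    apply Rplus_le_compat; apply expo_bound; auto; [apply H|apply H'].
  - intros y _. rewrite (expo_0 (al N) (be N)), (expo_0 (al' N') (be' N')). ring.
Qed.

Section Data.
Variables (f : Z -> R) (B : R).
Hypothesis Hf : forall y, Rabs (f y) <= B.

Lemma semi_lim (t : R) (x : Z) : 0 <= t ->
  is_lim_seq (fun N => expo (trunc N a) (trunc N b) (maxrate a b N) t f x) (semi a b t f x).
Proof.
  intros Ht. apply Lim_seq_correct', ex_lim_seq_cauchy_corr.
  intros [eps Heps].
  pose proof (approx_trunc a b Hab) as H.
  destruct (expo_cauchy _ _ _ _ _ _ f B t (eps / 2) x H H Hf Ht ltac:(lra)) as [M0 HM].
  exists M0. intros n m Hn Hm. simpl. specialize (HM n m Hn Hm). lra.
Qed.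

Lemma semi_approx al be c (t : R) (x : Z) : approx a b al be c -> 0 <= t ->
  is_lim_seq (fun N => expo (al N) (be N) (c N) t f x) (semi a b t f x).
Proof.
  intros H Ht.
  apply is_lim_seq_ext with (fun N => expo (trunc N a) (trunc N b) (maxrate a b N) t f x
    + (expo (al N) (be N) (c N) t f x
       - expo (trunc N a) (trunc N b) (maxrate a b N) t f x)).
  { intros N; ring. }
  replace (Finite (semi a b t f x)) with (Finite (semi a b t f x + 0)) by (f_equal; ring).
  apply is_lim_seq_plus'; [now apply semi_lim|].
  apply is_lim_seq_spec. intros [eps Heps]. simpl.
  pose proof (approx_trunc a b Hab) as H'.
  destruct (expo_cauchy _ _ _ _ _ _ f B t (eps / 2) x H H' Hf Ht ltac:(lra)) as [M0 HM].
  exists M0. intros n Hn. specialize (HM n n Hn Hn). rewrite Rminus_0_r. lra.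
Qed.

Lemma semi_bound (t : R) (x : Z) : 0 <= t -> Rabs (semi a b t f x) <= B.
Proof.
  intros Ht.
  apply (is_lim_seq_le (fun N => Rabs (expo (trunc N a) (trunc N b) (maxrate a b N) t f x))
    (fun _ => B) (Rabs (semi a b t f x)) B).
  - intros N. apply expo_bound; auto. apply (approx_trunc a b Hab).
  - apply (is_lim_seq_abs _ (Finite _)), semi_lim, Ht.
  - apply is_lim_seq_const.
Qed.

Lemma semi_0 (x : Z) : semi a b 0 f x = f x.
Proof.
  unfold semi. rewrite (Lim_seq_ext _ (fun _ => f x)).
  - now rewrite Lim_seq_const.
  - intros N. apply expo_0.
Qed.

Lemma semi_taylor (t s : R) (x : Z) : 0 <= t -> 0 <= s ->
  Rabs (semi a b (t + s) f x - semi a b t f x - s * gen a b (semi a b t f) x)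
    <= curv a b x * B * s ^ 2.
Proof.
  intros Ht Hs.
  set (E := fun N t => expo (trunc N a) (trunc N b) (maxrate a b N) t f).
  assert (HE : forall r y, 0 <= r -> is_lim_seq (fun N => E N r y) (semi a b r f y))
    by (intros; now apply semi_lim).
  apply (is_lim_seq_le_loc
    (fun N => Rabs (E N (t + s) x - E N t x - s * gen a b (E N t) x))
    (fun _ => curv a b x * B * s ^ 2)
    (Rabs (semi a b (t + s) f x - semi a b t f x - s * gen a b (semi a b t f) x))
    (curv a b x * B * s ^ 2)).
  (* Once [x] lies in the window, the truncated generator at [x] is the original one. *)
  - exists (Z.to_nat (Z.abs x)). intros N HN.
    destruct (approx_trunc a b Hab N) as [Hb [Hl He]].
    destruct (He x ltac:(lia)) as [Ea Eb].
    unfold gen. rewrite <- Ea, <- Eb. apply (expo_taylor _ _ _ B f Hb Hf a b); auto.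
  - apply (is_lim_seq_abs _ (Finite _)). apply is_lim_seq_minus'.
    + apply is_lim_seq_minus'; apply HE; lra.
    + apply is_lim_seq_mult'; [apply is_lim_seq_const|]. unfold gen.
      apply is_lim_seq_plus'; apply is_lim_seq_mult'; try apply is_lim_seq_const;
        apply is_lim_seq_minus'; apply HE; lra.
  - apply is_lim_seq_const.
Qed.

Lemma semi_qsol (M : Z) : qsol_on M a b (fun t => semi a b t f).
Proof.
  exists (fun x => curv a b x * B). intros x t s _ Ht Hs. now apply semi_taylor.
Qed.

End Data.

Lemma qsol_zero (u : R -> Z -> R) (B t : R) (x : Z) :
  (forall M, qsol_on M a b u) -> (forall s y, 0 <= s -> Rabs (u s y) <= B) ->
  (forall y, u 0 y = 0) -> 0 <= t -> u t x = 0.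
Proof.
  intros Hu HB H0 Ht.
  assert (B0 : 0 <= B) by (eapply Rle_trans; [apply Rabs_pos|apply (HB 0 0%Z); lra]).
  enough (H : Rabs (u t x) <= 0).
  { apply Rabs_le_between in H. lra. }
  apply le_epsilon. intros eps Heps. rewrite Rplus_0_l.
  destruct (solution_small a b h C B t eps x) as [M0 HM0]; auto.
  apply (HM0 M0 u); auto.
Qed.

Lemma semi_unique (u : R -> Z -> R) (f : Z -> R) (B B' t : R) (x : Z) :
  (forall y, Rabs (f y) <= B) ->
  (forall M, qsol_on M a b u) -> (forall s y, 0 <= s -> Rabs (u s y) <= B') ->
  (forall y, u 0 y = f y) -> 0 <= t -> u t x = semi a b t f x.
Proof.
  intros Hf Hu HB H0 Ht.
  enough (1 * u t x + -1 * semi a b t f x = 0) by lra.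
  apply (qsol_zero (fun s y => 1 * u s y + -1 * semi a b s f y) (B' + B)); auto.
  - intros M. apply qsol_on_lin; [auto|]. eapply semi_qsol; eauto.
  - intros s y Hs. replace (_ + _) with (u s y - semi a b s f y) by ring.
    eapply Rle_trans; [apply Rabs_triang|]. rewrite Rabs_Ropp.
    apply Rplus_le_compat; auto. now apply semi_bound.
  - intros y. rewrite H0, semi_0. ring.
Qed.

Lemma semi_lin (f g : Z -> R) (Bf Bg c d t : R) (x : Z) :
  (forall y, Rabs (f y) <= Bf) -> (forall y, Rabs (g y) <= Bg) -> 0 <= t ->
  semi a b t (fun y => c * f y + d * g y) x = c * semi a b t f x + d * semi a b t g x.
Proof.
  intros Hf Hg Ht. symmetry.
  assert (Hb : forall u v, Rabs u <= Bf -> Rabs v <= Bg ->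
    Rabs (c * u + d * v) <= Rabs c * Bf + Rabs d * Bg).
  { intros u v Hu Hv. eapply Rle_trans; [apply Rabs_triang|]. rewrite !Rabs_mult.
    apply Rplus_le_compat; apply Rmult_le_compat_l; auto using Rabs_pos. }
  apply (semi_unique (fun s y => c * semi a b s f y + d * semi a b s g y)
    (fun y => c * f y + d * g y) (Rabs c * Bf + Rabs d * Bg) (Rabs c * Bf + Rabs d * Bg)); auto.
  - intros M. apply qsol_on_lin; eapply semi_qsol; eauto.
  - intros s y Hs. apply Hb; now apply semi_bound.
  - intros y. now rewrite !semi_0.
Qed.

(** A bounded function with [L f = 0], held constant in time, is a bounded solution; uniqueness does
    the rest. *)
Lemma semi_stationary (f : Z -> R) (B t : R) (x : Z) :
  (forall y, Rabs (f y) <= B) -> (forall y, gen a b f y = 0) -> 0 <= t ->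
  semi a b t f x = f x.
Proof.
  intros Hf Hg Ht. symmetry. apply (semi_unique (fun _ => f) f B B); auto.
  intros M. exists (fun _ => 0). intros y r s _ _ _. rewrite Hg.
  rewrite Rmult_0_r, Rmult_0_l, Rminus_0_r, Rminus_diag, Rabs_R0. lra.
Qed.

(** Honesty: constants are harmonic, so no mass escapes to infinity. *)
Lemma semi_const (c t : R) (x : Z) : 0 <= t -> semi a b t (fun _ => c) x = c.
Proof.
  intros Ht. apply (semi_stationary (fun _ => c) (Rabs c)); auto.
  - intros _. lra.
  - intros y. unfold gen. ring.
Qed.

(** Positivity follows from contraction and honesty: [f - B / 2] has absolute value at most [B / 2],
    hence so has its image, which is the image of [f] minus [B / 2]. *)
Lemma semi_nonneg (f : Z -> R) (B t : R) (x : Z) :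
  (forall y, 0 <= f y <= B) -> 0 <= t -> 0 <= semi a b t f x.
Proof.
  intros Hf Ht.
  assert (Hf' : forall y, Rabs (f y) <= B).
  { intros y. specialize (Hf y). apply Rabs_le. lra. }
  assert (H1 : forall y : Z, Rabs 1 <= 1) by (intros; rewrite Rabs_R1; lra).
  pose proof (semi_lin f (fun _ => 1) B 1 1 (- B / 2) t x Hf' H1 Ht) as E.
  rewrite semi_const in E by auto.
  assert (Hb : Rabs (semi a b t (fun y => 1 * f y + - B / 2 * 1) x) <= B / 2).
  { apply semi_bound; auto. intros y. specialize (Hf y). apply Rabs_le. lra. }
  rewrite E in Hb. apply Rabs_le_between in Hb. lra.
Qed.

(** This takes the place of countable additivity of a transition measure: data that agree on a large
    window are indistinguishable at [(t, x)] up to a small error. *)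
Lemma semi_cont (f : Z -> R) (fN : nat -> Z -> R) (B t : R) (x : Z) :
  (forall y, Rabs (f y) <= B) -> (forall N y, Rabs (fN N y) <= B) ->
  (forall N y, (Z.abs y <= Z.of_nat N)%Z -> fN N y = f y) -> 0 <= t ->
  is_lim_seq (fun N => semi a b t (fN N) x) (semi a b t f x).
Proof.
  intros Hf HfN Heq Ht.
  assert (B0 : 0 <= B) by (eapply Rle_trans; [apply Rabs_pos|apply (Hf 0%Z)]).
  apply is_lim_seq_spec. intros [eps Heps]. simpl.
  destruct (solution_small a b h C (B + B) t (eps / 2) x) as [M0 HM0]; auto; try lra.
  exists M0. intros N HN.
  enough (Rabs (1 * semi a b t (fN N) x + -1 * semi a b t f x) <= eps / 2).
  { replace (_ - _) with (1 * semi a b t (fN N) x + -1 * semi a b t f x) by ring. lra. }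
  apply (HM0 N (fun s y => 1 * semi a b s (fN N) y + -1 * semi a b s f y)); auto.
  - apply qsol_on_lin; eapply semi_qsol; eauto.
  - intros s y Hs. replace (_ + _) with (semi a b s (fN N) y - semi a b s f y) by ring.
    eapply Rle_trans; [apply Rabs_triang|]. rewrite Rabs_Ropp.
    apply Rplus_le_compat; now apply semi_bound.
  - intros y Hy. rewrite !semi_0, Heq; auto. ring.
Qed.

Definition lip (B : R) (y : Z) : R := 2 * B * (a y + b y) + Rabs (curv a b y * B).

Lemma semi_lipschitz (f : Z -> R) (B r s : R) (y : Z) :
  (forall z, Rabs (f z) <= B) -> 0 <= r -> 0 <= s <= 1 ->
  Rabs (semi a b (r + s) f y - semi a b r f y) <= lip B y * s.
Proof.
  intros Hf Hr Hs.
  pose proof (semi_taylor f B Hf r s y Hr ltac:(lra)) as T.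
  set (g := gen a b (semi a b r f) y) in *.
  assert (Hg : Rabs g <= 2 * B * (a y + b y)).
  { apply gen_bound; auto. intros z. now apply semi_bound. }
  replace (semi a b (r + s) f y - semi a b r f y)
    with ((semi a b (r + s) f y - semi a b r f y - s * g) + s * g) by ring.
  eapply Rle_trans; [apply Rabs_triang|]. rewrite (Rabs_mult s), (Rabs_right s) by lra.
  pose proof (Rle_abs (curv a b y * B)). pose proof (Rabs_pos (curv a b y * B)).
  assert (curv a b y * B * s ^ 2 <= Rabs (curv a b y * B) * s).
  { apply Rle_trans with (Rabs (curv a b y * B) * s ^ 2).
    - apply Rmult_le_compat_r; [apply pow2_ge_0|lra].
    - apply Rmult_le_compat_l; [lra|]. simpl. nra. }
  assert (s * Rabs g <= s * (2 * B * (a y + b y))) by (apply Rmult_le_compat_l; lra).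
  unfold lip. lra.
Qed.

Lemma lip_nonneg (B : R) (y : Z) : 0 <= B -> 0 <= lip B y.
Proof.
  intros B0. destruct (Hab y). unfold lip. pose proof (Rabs_pos (curv a b y * B)).
  assert (0 <= 2 * B * (a y + b y)) by (apply Rmult_le_pos; lra). lra.
Qed.

Lemma semi_right_cont (f : Z -> R) (B : R) (x : Z) (eps : R) :
  (forall y, Rabs (f y) <= B) -> 0 < eps ->
  exists delta, 0 < delta /\ forall s, 0 < s < delta ->
    Rabs (semi a b s f x - semi a b 0 f x) < eps.
Proof.
  intros Hf Heps.
  assert (B0 : 0 <= B) by (eapply Rle_trans; [apply Rabs_pos|apply (Hf 0%Z)]).
  set (K := lip B x + 1).
  assert (HK : 0 < K) by (pose proof (lip_nonneg B x B0); unfold K; lra).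
  exists (Rmin 1 (eps / K)). split.
  { apply Rmin_glb_lt; [lra|]. now apply Rdiv_lt_0_compat. }
  intros s [Hs0 Hs]. pose proof (Rmin_l 1 (eps / K)). pose proof (Rmin_r 1 (eps / K)).
  pose proof (semi_lipschitz f B 0 s x Hf ltac:(lra) ltac:(lra)) as T. rewrite Rplus_0_l in T.
  apply Rle_lt_trans with (1 := T). apply Rle_lt_trans with (K * s).
  - apply Rmult_le_compat_r; unfold K; lra.
  - apply Rlt_le_trans with (K * (eps / K)); [apply Rmult_lt_compat_l; lra|].
    right; field; lra.
Qed.

(** The Taylor estimate only looks forward in time. For [s < 0] it is applied from [r = t + s] up to
    [t], and the generator at time [r] is moved to time [t] by the Lipschitz bounds at [x] and its
    neighbours; [K] collects both errors. *)
Lemma semi_derive (f : Z -> R) (B t : R) (x : Z) :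
  (forall y, Rabs (f y) <= B) -> 0 < t ->
  derivable_pt_lim (fun s => semi a b s f x) t (gen a b (semi a b t f) x).
Proof.
  intros Hf Ht.
  assert (B0 : 0 <= B) by (eapply Rle_trans; [apply Rabs_pos|apply (Hf 0%Z)]).
  set (k := lip B).
  destruct (Hab x) as [Ha Hb].
  set (K := Rabs (curv a b x * B) + a x * (k (x + 1)%Z + k x) + b x * (k (x - 1)%Z + k x) + 1).
  assert (Hk : forall y, 0 <= k y).
  { intros y. now apply lip_nonneg. }
  assert (HK1 : 0 <= a x * (k (x + 1)%Z + k x))
    by (apply Rmult_le_pos; [auto|]; pose proof (Hk x); pose proof (Hk (x + 1)%Z); lra).
  assert (HK2 : 0 <= b x * (k (x - 1)%Z + k x))
    by (apply Rmult_le_pos; [auto|]; pose proof (Hk x); pose proof (Hk (x - 1)%Z); lra).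
  pose proof (Rabs_pos (curv a b x * B)) as HK3.
  pose proof (Rle_abs (curv a b x * B)) as HK4.
  assert (HK : 0 < K) by (unfold K; lra).
  assert (Est : forall s, - Rmin 1 t < s < 1 ->
    Rabs (semi a b (t + s) f x - semi a b t f x - s * gen a b (semi a b t f) x) <= K * s ^ 2).
  { intros s Hs. pose proof (Rmin_l 1 t). pose proof (Rmin_r 1 t).
    pose proof (pow2_ge_0 s) as Hs2.
    destruct (Rle_dec 0 s) as [Hs0|Hs0].
    - eapply Rle_trans; [apply (semi_taylor f B); auto; lra|].
      apply Rmult_le_compat_r; [auto|]. unfold K; lra.
    - set (r := t + s).
      pose proof (semi_taylor f B Hf r (- s) x ltac:(unfold r; lra) ltac:(lra)) as T.
      replace (r + - s) with t in T by (unfold r; ring).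
      assert (D : forall y, Rabs (semi a b t f y - semi a b r f y) <= k y * - s).
      { intros y. replace t with (r + - s) by (unfold r; ring).
        apply semi_lipschitz; auto; unfold r; lra. }
      assert (HG : Rabs (gen a b (semi a b t f) x - gen a b (semi a b r f) x)
        <= (K - Rabs (curv a b x * B)) * - s).
      { replace (gen a b (semi a b t f) x - gen a b (semi a b r f) x) with
          (a x * ((semi a b t f (x + 1)%Z - semi a b r f (x + 1)%Z)
                  - (semi a b t f x - semi a b r f x))
           + b x * ((semi a b t f (x - 1)%Z - semi a b r f (x - 1)%Z)
                  - (semi a b t f x - semi a b r f x))) by (unfold gen; ring).
        eapply Rle_trans; [apply Rabs_triang|].
        rewrite (Rabs_mult (a x)), (Rabs_mult (b x)), (Rabs_right (a x)), (Rabs_right (b x))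
          by lra.
        assert (Q : forall u v p q, Rabs u <= p * - s -> Rabs v <= q * - s ->
          Rabs (u - v) <= (p + q) * - s).
        { intros u v p q Hu Hv. eapply Rle_trans; [apply Rabs_triang|].
          rewrite Rabs_Ropp. lra. }
        pose proof (Rmult_le_compat_l _ _ _ Ha (Q _ _ _ _ (D (x + 1)%Z) (D x))).
        pose proof (Rmult_le_compat_l _ _ _ Hb (Q _ _ _ _ (D (x - 1)%Z) (D x))).
        unfold K. lra. }
      replace (semi a b r f x - semi a b t f x - s * gen a b (semi a b t f) x) with
        (- (semi a b t f x - semi a b r f x - - s * gen a b (semi a b r f) x)
         + - s * (gen a b (semi a b t f) x - gen a b (semi a b r f) x)) by ring.
      eapply Rle_trans; [apply Rabs_triang|].
      rewrite Rabs_Ropp, (Rabs_mult (- s)), (Rabs_right (- s)) by lra.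
      pose proof (Rmult_le_compat_l (- s) _ _ ltac:(lra) HG).
      assert (curv a b x * B * (- s) ^ 2 <= Rabs (curv a b x * B) * s ^ 2).
      { replace ((- s) ^ 2) with (s ^ 2) by ring. apply Rmult_le_compat_r; lra. }
      replace (K * s ^ 2) with (Rabs (curv a b x * B) * s ^ 2 +
        - s * ((K - Rabs (curv a b x * B)) * - s)) by ring.
      lra. }
  intros eps Heps.
  assert (Hd : 0 < Rmin (Rmin 1 t) (eps / (2 * K))).
  { apply Rmin_glb_lt; [apply Rmin_glb_lt; lra|]. apply Rdiv_lt_0_compat; lra. }
  exists (mkposreal _ Hd). intros s Hs0 Hs. simpl in Hs.
  pose proof (Rmin_l (Rmin 1 t) (eps / (2 * K))). pose proof (Rmin_r (Rmin 1 t) (eps / (2 * K))).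
  pose proof (Rmin_l 1 t).
  assert (Hs' : Rabs s < Rmin 1 t) by lra. apply Rabs_lt_between in Hs'.
  specialize (Est s ltac:(lra)).
  replace ((semi a b (t + s) f x - semi a b t f x) / s - gen a b (semi a b t f) x)
    with ((semi a b (t + s) f x - semi a b t f x - s * gen a b (semi a b t f) x) / s)
    by (field; auto).
  assert (Hsp : 0 < Rabs s) by now apply Rabs_pos_lt.
  rewrite Rabs_div by auto. apply (Rmult_lt_reg_r (Rabs s)); [auto|].
  unfold Rdiv at 1. rewrite Rmult_assoc, Rinv_l, Rmult_1_r by lra.
  apply Rle_lt_trans with (1 := Est). rewrite <- (pow2_abs s).
  replace (K * Rabs s ^ 2) with (K * Rabs s * Rabs s) by ring.
  apply Rmult_lt_compat_r; [auto|].
  apply Rle_lt_trans with (K * (eps / (2 * K))); [apply Rmult_le_compat_l; lra|].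
  replace (K * (eps / (2 * K))) with (eps / 2) by (field; lra). lra.
Qed.

End Semigroup.

(** * Duality, reversibility and transition kernels *)

Definition delta (y x : Z) : R := if Z.eq_dec x y then 1 else 0.

Definition indic (c : Z -> bool) (x : Z) : R := if c x then 1 else 0.

Lemma delta_bound (y x : Z) : Rabs (delta y x) <= 1.
Proof. unfold delta. destruct (Z.eq_dec x y); rewrite ?Rabs_R1, ?Rabs_R0; lra. Qed.

Lemma indic_bound (c : Z -> bool) (x : Z) : Rabs (indic c x) <= 1.
Proof. unfold indic. destruct (c x); rewrite ?Rabs_R1, ?Rabs_R0; lra. Qed.

Lemma powstep_lin (a b : Z -> R) (c : R) (k : nat) (f g : Z -> R) (r s : R) (x : Z) :
  powstep a b c k (fun z => r * f z + s * g z) x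
  = r * powstep a b c k f x + s * powstep a b c k g x.
Proof.
  revert x. induction k as [|k IH]; intros x; [reflexivity|].
  change (step a b c (powstep a b c k (fun z => r * f z + s * g z)) x =
    r * step a b c (powstep a b c k f) x + s * step a b c (powstep a b c k g) x).
  unfold step, gen. rewrite !IH. ring.
Qed.

Lemma powstep_succ_r (a b : Z -> R) (c : R) (k : nat) (f : Z -> R) :
  powstep a b c (S k) f = powstep a b c k (step a b c f).
Proof. apply Nat.iter_succ_r. Qed.

Lemma powstep_step_commute (a b a' b' : Z -> R) (c : R) (k : nat) (G : Z -> Z -> R) (y x : Z) :
  step a b c (fun z => powstep a' b' c k (G z) x) y
  = powstep a' b' c k (fun w => step a b c (fun z => G z w) y) x.
Proof.
  revert x. induction k as [|k IH]; intros x; [reflexivity|].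
  change (step a b c (fun z => step a' b' c (powstep a' b' c k (G z)) x) y =
    step a' b' c (powstep a' b' c k (fun w => step a b c (fun z => G z w) y)) x).
  unfold step at 3. unfold gen. rewrite <- !IH. unfold step, gen. ring.
Qed.

(** One application of the generator is exchanged by the one-step identity for the indicator, and it
    passes through the remaining powers because the two operators act on different variables. *)
Lemma powstep_dual (a b : Z -> R) (c : R) (k : nat) (y x : Z) :
  powstep a b c k (indic (fun z => z <=? x)%Z) y
  = powstep (fun z => b (z + 1)%Z) a c k (indic (fun w => y <=? w)%Z) x.
Proof.
  revert y x. induction k as [|k IH]; intros y x; [reflexivity|].
  rewrite (powstep_succ_r (fun z => b (z + 1)%Z)).
  change (powstep a b c (S k)) with (fun f => step a b c (powstep a b c k f)). cbv beta.
  transitivity (step a b c (fun z =>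
    powstep (fun z => b (z + 1)%Z) a c k (indic (fun w => z <=? w)%Z) x) y).
  { apply (f_equal (fun g => step a b c g y)). apply functional_extensionality.
    intros z. apply IH. }
  rewrite powstep_step_commute.
  apply (f_equal (fun g => powstep (fun z => b (z + 1)%Z) a c k g x)).
  apply functional_extensionality. intros w.
  unfold step, gen, indic.
  destruct (Z.leb_spec y w), (Z.leb_spec (y + 1) w), (Z.leb_spec (y - 1) w),
    (Z.leb_spec y (w + 1)), (Z.leb_spec y (w - 1)); try lia; try ring.
  (* Only here does the indicator jump: at [w = y] it is lost at rate [a y], at [w = y - 1] it is
     gained at rate [b y = b (w + 1)], whence the shift in the dual up-rate. *)
  - assert (w = y) as -> by lia. ring.
  - assert (w = y - 1)%Z as -> by lia. replace (y - 1 + 1)%Z with y by lia. ring.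
Qed.

(* The dual of the truncated chain is an approximation of the dual chain. *)
Lemma semi_dual (a b h h' : Z -> R) (C C' t : R) (x y : Z) :
  rates a b -> lyapunov a b h C -> lyapunov (fun z => b (z + 1)%Z) a h' C' -> 0 <= t ->
  semi a b t (indic (fun z => z <=? x)%Z) y
  = semi (fun z => b (z + 1)%Z) a t (indic (fun w => y <=? w)%Z) x.
Proof.
  intros Hab HL HL' Ht.
  assert (Hab' : rates (fun z => b (z + 1)%Z) a).
  { intros z. destruct (Hab z), (Hab (z + 1)%Z). auto. }
  (* One constant for both series. It is doubled because the dual takes [b (z + 1)] and [a z] from
     two different sites, and the cut is at [S N] because [z + 1] may leave the window of radius
     [N]. *)
  set (c := fun N : nat => maxrate a b (S N) + maxrate a b (S N)).
  assert (Htr : forall N z, 0 <= trunc (S N) a z <= a z /\ 0 <= trunc (S N) b z <= b z /\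
      trunc (S N) a z + trunc (S N) b z <= maxrate a b (S N)).
  { intros N z. destruct (approx_trunc a b Hab (S N)) as [[H1 H2] [H3 H4]].
    destruct (H1 z), (H3 z). specialize (H2 z). auto. }
  assert (A1 : approx a b (fun N => trunc (S N) a) (fun N => trunc (S N) b) c).
  { intros N. pose proof (maxrate_nonneg a b (S N) Hab). split; [split|split].
    - intros z; destruct (Htr N z) as (? & ? & ?). lra.
    - intros z; destruct (Htr N z) as (? & ? & ?). unfold c. lra.
    - intros z; destruct (Htr N z) as (? & ? & ?). lra.
    - intros z Hz. apply (approx_trunc a b Hab (S N)). lia. }
  assert (A2 : approx (fun z => b (z + 1)%Z) a
    (fun N z => trunc (S N) b (z + 1)%Z) (fun N => trunc (S N) a) c).
  { intros N. split; [split|split].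
    - intros z; destruct (Htr N z) as (? & ? & ?), (Htr N (z + 1)%Z) as (? & ? & ?). lra.
    - intros z; destruct (Htr N z) as (? & ? & ?), (Htr N (z + 1)%Z) as (? & ? & ?).
      unfold c. lra.
    - intros z; destruct (Htr N z) as (? & ? & ?), (Htr N (z + 1)%Z) as (? & ? & ?). lra.
    - intros z Hz. split; apply (approx_trunc a b Hab (S N)); lia. }
  pose proof (semi_approx a b h C Hab HL _ 1 (indic_bound (fun z => z <=? x)%Z) _ _ _ t y A1 Ht)
    as L1.
  pose proof (semi_approx _ _ h' C' Hab' HL' _ 1 (indic_bound (fun w => y <=? w)%Z)
    _ _ _ t x A2 Ht) as L2.
  apply is_lim_seq_unique in L1, L2.
  enough (Finite (semi a b t (indic (fun z => z <=? x)%Z) y) =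
    Finite (semi (fun z => b (z + 1)%Z) a t (indic (fun w => y <=? w)%Z) x)) by congruence.
  rewrite <- L1, <- L2. apply Lim_seq_ext. intros N. unfold expo. f_equal.
  apply PSeries_ext. intros k. f_equal. apply powstep_dual.
Qed.

Lemma powstep_absorbing (a b : Z -> R) (c : R) (k : nat) (f : Z -> R) (x : Z) :
  a x = 0 -> b x = 0 -> powstep a b c k f x = c ^ k * f x.
Proof.
  intros Ha Hb. induction k as [|k IH]; simpl; [ring|].
  change (step a b c (powstep a b c k f) x = c * c ^ k * f x).
  unfold step, gen. rewrite Ha, Hb, IH. ring.
Qed.

Lemma semi_absorbing (a b h : Z -> R) (C B t : R) (f : Z -> R) (x : Z) :
  rates a b -> lyapunov a b h C -> (forall y, Rabs (f y) <= B) -> 0 <= t ->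
  a x = 0 -> b x = 0 -> semi a b t f x = f x.
Proof.
  intros Hab HL Hf Ht Ha Hb.
  pose proof (semi_lim a b h C Hab HL f B Hf t x Ht) as L. apply is_lim_seq_unique in L.
  enough (Finite (semi a b t f x) = Finite (f x)) by congruence.
  rewrite <- L, (Lim_seq_ext _ (fun _ => f x)); [apply Lim_seq_const|].
  intros N. unfold expo.
  rewrite (PSeries_ext _ (PS_scal (f x) (fun k => / INR (fact k) * maxrate a b N ^ k))).
  - rewrite PSeries_scal.
    replace (PSeries _ t) with (exp (maxrate a b N * t)).
    + rewrite exp_Ropp. field. apply Rgt_not_eq, exp_pos.
    + rewrite <- (is_series_unique _ _ (exp_series (maxrate a b N * t))).
      apply Series_ext.
      intros k. rewrite Rpow_mult_distr. unfold Rdiv. ring.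
  - intros k. unfold PS_scal, scal; simpl; unfold mult; simpl.
    rewrite powstep_absorbing.
    + unfold Rdiv. ring.
    + unfold trunc. destruct (_ <=? _)%Z; auto.
    + unfold trunc. destruct (_ <=? _)%Z; auto.
Qed.

(** The forward form of the generator: [y] is entered from [y - 1] by an up-jump and from [y + 1] by
    a down-jump. *)
Lemma step_delta (a b : Z -> R) (c : R) (y : Z) :
  step a b c (delta y) = fun z => 1 * (a (y - 1)%Z * delta (y - 1) z + b (y + 1)%Z * delta (y + 1) z)
    + (c - a y - b y) * delta y z.
Proof.
  apply functional_extensionality. intros z. unfold step, gen, delta.
  destruct (Z.eq_dec z y) as [->|N1].
  - destruct (Z.eq_dec (y + 1) y), (Z.eq_dec (y - 1) y), (Z.eq_dec y (y - 1)),
      (Z.eq_dec y (y + 1)); try lia. ring.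
  - destruct (Z.eq_dec z (y - 1)) as [->|N2].
    + replace (y - 1 + 1)%Z with y by lia. replace (y - 1 - 1)%Z with (y - 2)%Z by lia.
      destruct (Z.eq_dec y y), (Z.eq_dec (y - 2) y), (Z.eq_dec (y - 1) (y + 1)); try lia. ring.
    + destruct (Z.eq_dec z (y + 1)) as [->|N3].
      * replace (y + 1 - 1)%Z with y by lia.
        destruct (Z.eq_dec y y), (Z.eq_dec (y + 1 + 1) y); try lia. ring.
      * destruct (Z.eq_dec (z + 1) y), (Z.eq_dec (z - 1) y); try lia. ring.
Qed.

(** Detailed balance makes [L] symmetric with respect to [w]: a backward step from [x] on one side
    matches a forward step applied to [delta x] on the other. A neighbour outside [S] is absorbing
    and distinct from [y], so its terms vanish on both sides. *)
Lemma powstep_reversible (S : Z -> bool) (a b w : Z -> R) (c : R) (k : nat) (x y : Z) :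
  (forall z, S z = false -> a z = 0 /\ b z = 0) ->
  (forall z, S z = true -> S (z + 1)%Z = true -> w z * a z = w (z + 1)%Z * b (z + 1)%Z) ->
  S x = true -> S y = true ->
  w x * powstep a b c k (delta y) x = w y * powstep a b c k (delta x) y.
Proof.
  intros Habs Hbal. revert x y. induction k as [|k IH]; intros x y Hx Hy.
  - unfold powstep, delta; simpl. destruct (Z.eq_dec x y), (Z.eq_dec y x);
      subst; try congruence; ring.
  - rewrite (powstep_succ_r _ _ _ _ (delta x)), step_delta, !powstep_lin.
    change (powstep a b c (Datatypes.S k) (delta y)) with (step a b c (powstep a b c k (delta y))).
    unfold step, gen.
    assert (U : w x * a x * powstep a b c k (delta y) (x + 1)%Z =
      w y * (b (x + 1)%Z * powstep a b c k (delta (x + 1)) y)).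
    { destruct (S (x + 1)%Z) eqn:E.
      - rewrite Hbal by auto.
        rewrite (Rmult_comm (w (x + 1)%Z)), Rmult_assoc, IH by auto. ring.
      - destruct (Habs _ E) as [E1 E2]. rewrite E2, powstep_absorbing by auto.
        unfold delta at 1. destruct (Z.eq_dec (x + 1) y); [congruence|ring]. }
    assert (V : w x * b x * powstep a b c k (delta y) (x - 1)%Z =
      w y * (a (x - 1)%Z * powstep a b c k (delta (x - 1)) y)).
    { destruct (S (x - 1)%Z) eqn:E.
      - pose proof (Hbal (x - 1)%Z E) as Q. replace (x - 1 + 1)%Z with x in Q by lia.
        rewrite <- Q by auto.
        rewrite (Rmult_comm (w (x - 1)%Z)), Rmult_assoc, IH by auto. ring.
      - destruct (Habs _ E) as [E1 E2]. rewrite E1, powstep_absorbing by auto.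
        unfold delta at 1. destruct (Z.eq_dec (x - 1) y); [congruence|ring]. }
    pose proof (IH x y Hx Hy) as IHxy.
    replace (w x * (c * powstep a b c k (delta y) x
      + (a x * (powstep a b c k (delta y) (x + 1)%Z - powstep a b c k (delta y) x)
         + b x * (powstep a b c k (delta y) (x - 1)%Z - powstep a b c k (delta y) x))))
      with (w x * a x * powstep a b c k (delta y) (x + 1)%Z
        + w x * b x * powstep a b c k (delta y) (x - 1)%Z
        + (c - a x - b x) * (w x * powstep a b c k (delta y) x)) by ring.
    rewrite U, V, IHxy. ring.
Qed.

Lemma semi_reversible (S : Z -> bool) (a b h w : Z -> R) (C t : R) (x y : Z) :
  rates a b -> lyapunov a b h C ->
  (forall z, S z = false -> a z = 0 /\ b z = 0) ->
  (forall z, S z = true -> S (z + 1)%Z = true -> w z * a z = w (z + 1)%Z * b (z + 1)%Z) ->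
  S x = true -> S y = true -> 0 <= t ->
  w x * semi a b t (delta y) x = w y * semi a b t (delta x) y.
Proof.
  intros Hab HL Habs Hbal Hx Hy Ht.
  (* [chi N z] keeps the edge between [z] and [z + 1]. Cutting edges removes both directions
     together, so detailed balance holds for the truncated rates. The outermost edges reach sites of
     modulus [N + 1], hence [maxrate] at [N + 1]. *)
  set (chi := fun (N : nat) (z : Z) => ((- Z.of_nat N - 1 <=? z) && (z <=? Z.of_nat N))%Z).
  set (al := fun N z => if chi N z then a z else 0).
  set (be := fun N z => if chi N (z - 1)%Z then b z else 0).
  assert (A : approx a b al be (fun N => maxrate a b (Datatypes.S N))).
  { intros N. split; [split|split].
    - intros z. unfold al, be. destruct (Hab z), (chi N z), (chi N (z - 1)%Z); lra.
    - intros z. destruct (Hab z) as [Ha Hb]. unfold al, be.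
      destruct (Z_le_gt_dec (Z.abs z) (Z.of_nat (Datatypes.S N))) as [Hz|Hz].
      + pose proof (maxrate_ge a b _ z Hab Hz). destruct (chi N z), (chi N (z - 1)%Z); lra.
      + pose proof (maxrate_nonneg a b (Datatypes.S N) Hab).
        assert (E1 : chi N z = false) by (unfold chi; lia).
        assert (E2 : chi N (z - 1)%Z = false) by (unfold chi; lia).
        rewrite E1, E2. lra.
    - intros z. unfold al, be. destruct (Hab z), (chi N z), (chi N (z - 1)%Z); lra.
    - intros z Hz. unfold al, be.
      assert (E1 : chi N z = true) by (unfold chi; lia).
      assert (E2 : chi N (z - 1)%Z = true) by (unfold chi; lia).
      now rewrite E1, E2. }
  pose proof (semi_approx a b h C Hab HL _ 1 (delta_bound y) _ _ _ t x A Ht) as L1.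
  pose proof (semi_approx a b h C Hab HL _ 1 (delta_bound x) _ _ _ t y A Ht) as L2.
  apply (is_lim_seq_mult' _ _ (w x) _ (is_lim_seq_const _)) in L1.
  apply (is_lim_seq_mult' _ _ (w y) _ (is_lim_seq_const _)) in L2.
  apply is_lim_seq_unique in L1, L2.
  match type of L1 with _ = Finite ?u => match type of L2 with _ = Finite ?v =>
    enough (Finite u = Finite v) by congruence end end.
  rewrite <- L1, <- L2. apply Lim_seq_ext. intros N. unfold expo.
  enough (E : w x * PSeries (fun k => powstep (al N) (be N) (maxrate a b (Datatypes.S N)) k
      (delta y) x / INR (fact k)) t = w y * PSeries (fun k => powstep (al N) (be N)
      (maxrate a b (Datatypes.S N)) k (delta x) y / INR (fact k)) t).
  { rewrite !(Rmult_comm (exp _)), <- !Rmult_assoc. now rewrite E. }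
  rewrite <- !PSeries_scal. apply PSeries_ext. intros k.
  unfold PS_scal, scal; simpl; unfold mult; simpl. unfold Rdiv. rewrite <- !Rmult_assoc.
  f_equal. apply (powstep_reversible S); auto.
  - intros z Hz. destruct (Habs z Hz) as [E1 E2]. unfold al, be. rewrite E1, E2.
    destruct (chi N z), (chi N (z - 1)%Z); auto.
  - intros z Hz Hz'. unfold al, be. replace (z + 1 - 1)%Z with z by lia.
    destruct (chi N z); [auto|ring].
Qed.

(** * Transition kernels as images of point masses *)

Lemma nodup_zrange (N : nat) : NoDup (zrange N).
Proof. apply Injective_map_NoDup; [intros i j; lia|apply seq_NoDup]. Qed.

Lemma sumL_delta (l : list Z) (g : Z -> R) (x : Z) : NoDup l ->
  sumL l (fun z => g z * delta z x) = if in_dec Z.eq_dec x l then g x else 0.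
Proof.
  induction 1 as [|z l Hz Hl IH]; [reflexivity|].
  unfold sumL in *; simpl fold_right. rewrite IH. unfold delta.
  simpl. destruct (in_dec Z.eq_dec x l) as [Hx|Hx].
  - destruct (Z.eq_dec x z) as [->|]; [tauto|].
    destruct (Z.eq_dec z x); [congruence|]. ring.
  - destruct (Z.eq_dec z x) as [->|]; destruct (Z.eq_dec x x);
      try destruct (Z.eq_dec x z); try congruence; ring.
Qed.

Section KernelSums.
Variables (a b h : Z -> R) (C : R).
Hypothesis Hab : rates a b.
Hypothesis HL : lyapunov a b h C.

Lemma semi_sumL (l : list Z) (g : Z -> R) (t : R) (x : Z) : 0 <= t ->
  semi a b t (fun w => sumL l (fun z => g z * delta z w)) x
  = sumL l (fun z => g z * semi a b t (delta z) x).
Proof.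
  intros Ht.
  (* Boundedness of the finite sum travels with the induction because [semi_lin] asks for it. *)
  enough (H : (exists B, forall w, Rabs (sumL l (fun z => g z * delta z w)) <= B) /\
    semi a b t (fun w => sumL l (fun z => g z * delta z w)) x
    = sumL l (fun z => g z * semi a b t (delta z) x)) by tauto.
  induction l as [|z l [[B HB] IH]].
  - split; [exists 0; intros; unfold sumL; simpl; rewrite Rabs_R0; lra|].
    unfold sumL; simpl. now apply (semi_const a b h C).
  - split.
    + exists (Rabs (g z) + B). intros w. unfold sumL in *; simpl.
      eapply Rle_trans; [apply Rabs_triang|]. apply Rplus_le_compat; auto.
      rewrite Rabs_mult. rewrite <- (Rmult_1_r (Rabs (g z))) at 2.
      apply Rmult_le_compat_l; [apply Rabs_pos|apply delta_bound].
    + change (sumL (z :: l) (fun z0 => g z0 * semi a b t (delta z0) x))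
        with (g z * semi a b t (delta z) x + sumL l (fun z0 => g z0 * semi a b t (delta z0) x)).
      rewrite <- IH, <- (Rmult_1_l (semi a b t (fun w => sumL l _) x)).
      rewrite <- (semi_lin a b h C Hab HL _ _ 1 B) by (auto using delta_bound).
      f_equal. apply functional_extensionality. intros w. unfold sumL; simpl. ring.
Qed.

(** Finite sums are linearity; infinite ones are [semi_cont] for the restrictions of [indic c] to
    [zrange N]. *)
Lemma semi_kernel_sum (c : Z -> bool) (t : R) (x : Z) : 0 <= t ->
  is_lim_seq (fun N => sumL (zrange N) (fun z => if c z then semi a b t (delta z) x else 0))
    (semi a b t (indic c) x).
Proof.
  intros Ht.
  apply is_lim_seq_ext with
    (fun N => semi a b t (fun w => sumL (zrange N) (fun z => indic c z * delta z w)) x).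
  { intros N. rewrite semi_sumL by auto. unfold sumL. f_equal. apply map_ext. intros z.
    unfold indic. destruct (c z); ring. }
  apply (semi_cont a b h C Hab HL (indic c) _ 1); auto using indic_bound.
  - intros N y. rewrite sumL_delta by apply nodup_zrange.
    destruct (in_dec Z.eq_dec y (zrange N)); [apply indic_bound|rewrite Rabs_R0; lra].
  - intros N y Hy. rewrite sumL_delta by apply nodup_zrange.
    destruct (in_dec Z.eq_dec y (zrange N)) as [|H]; [auto|].
    now apply in_zrange in Hy.
Qed.

(* Minimality of [p] is only used to bound it by the semigroup; bounded solutions are unique. *)
Lemma transition_function_semi (isZ : bool) (al be : Z -> R) (p : R -> Z -> Z -> R) :
  (forall x, inIb isZ x = true -> a x = al x /\ b x = be x) ->
  (forall x, inIb isZ x = false -> a x = 0 /\ b x = 0) ->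
  transition_function isZ al be p ->
  forall t x y, 0 <= t -> inIb isZ x = true -> inIb isZ y = true ->
    p t x y = semi a b t (delta y) x.
Proof.
  intros Hin Hout [[Hpos [H0 [Hcont Hder]]] Hmin].
  assert (Hup : forall x, inIb isZ x = true -> inIb isZ (x + 1)%Z = true).
  { intros x. unfold inIb. destruct isZ; simpl; auto. lia. }
  assert (Hnn : forall t x y, 0 <= t -> 0 <= semi a b t (delta y) x).
  { intros t x y Ht. apply (semi_nonneg a b h C Hab HL _ 1); auto.
    intros z. unfold delta. destruct (Z.eq_dec z y); lra. }
  assert (Hq : backward_solution isZ al be (fun t x y => semi a b t (delta y) x)).
  { split; [|split; [|split]].
    - auto.
    - intros x y _ _. now rewrite semi_0.
    - intros x y _ _ eps Heps. apply (semi_right_cont a b h C Hab HL _ 1); auto using delta_bound.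
    - intros t x y Ht Hx Hy.
      pose proof (semi_derive a b h C Hab HL (delta y) 1 t x (delta_bound y) Ht) as D.
      destruct (Hin x Hx) as [Ea Eb]. rewrite (Hup x Hx), <- Ea, <- Eb.
      match goal with |- derivable_pt_lim _ _ ?l => replace l with
        (gen a b (semi a b t (delta y)) x) end; [exact D|].
      unfold gen. destruct (inIb isZ (x - 1)%Z) eqn:E; [ring|].
      destruct (Hout _ E) as [E1 E2].
      (* The killed equation has no term for [x - 1] outside [I]. The extended one has the value at
         an absorbing point, which is [delta y (x - 1) = 0] because [y] lies in [I]. *)
      rewrite (semi_absorbing a b h C 1 t (delta y) (x - 1)%Z); auto using delta_bound; [|lra].
      replace (delta y (x - 1)%Z) with 0; [ring|].
      unfold delta. destruct (Z.eq_dec (x - 1) y); congruence. }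
  assert (Hle : forall t x y, 0 <= t -> inIb isZ x = true -> inIb isZ y = true ->
    0 <= p t x y <= 1).
  { intros t x y Ht Hx Hy. split; [auto|].
    eapply Rle_trans; [apply (Hmin _ Hq); auto|].
    eapply Rle_trans; [apply Rle_abs|].
    apply (semi_bound a b h C Hab HL (delta y) 1); auto using delta_bound. }
  intros t x y Ht Hx Hy.
  (* Points outside [I] are absorbing, so extension by 0 makes [p] a bounded solution on all of
     [Z]. *)
  set (u := fun t x => if inIb isZ x then p t x y else 0).
  replace (p t x y) with (u t x) by (unfold u; now rewrite Hx).
  assert (HuB : forall s z, 0 <= s -> Rabs (u s z) <= 1).
  { intros s z Hs. unfold u. destruct (inIb isZ z) eqn:E; [|rewrite Rabs_R0; lra].
    specialize (Hle s z y Hs E Hy). apply Rabs_le. lra. }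
  apply (semi_unique a b h C Hab HL u (delta y) 1 1); auto using delta_bound.
  - intros M. exists (fun z => curv a b z * 1). intros z r s _ Hr Hs.
    apply (solution_taylor a b a b u 1); auto.
    + intros; split; lra.
    + intros s' z' Hs'. unfold u. destruct (inIb isZ z') eqn:E.
      * destruct (Hin z' E) as [Ea Eb].
        replace (gen a b _ z') with
          (- (al z' + be z') * p s' z' y
        + (if inIb isZ (z' + 1)%Z then al z' * p s' (z' + 1)%Z y else 0)
        + (if inIb isZ (z' - 1)%Z then be z' * p s' (z' - 1)%Z y else 0)); [auto|].
        unfold gen. rewrite E, Hup, Ea, Eb by auto. destruct (inIb isZ (z' - 1)%Z); ring.
      * destruct (Hout z' E) as [Ea Eb]. unfold gen. rewrite Ea, Eb, !Rmult_0_l, Rplus_0_l.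
        apply derivable_pt_lim_const.
    + intros z' eps Heps. unfold u. destruct (inIb isZ z') eqn:E; [auto|].
      exists 1. split; [lra|]. intros s' _. rewrite Rminus_0_r, Rabs_R0. auto.
  - intros z. unfold u. destruct (inIb isZ z) eqn:E; [now rewrite H0|].
    unfold delta. destruct (Z.eq_dec z y); [congruence|auto].
Qed.

End KernelSums.

(** * Natural boundaries *)

Lemma sumZ_empty (a b : Z) (f : Z -> R) : (b < a)%Z -> sumZ a b f = 0.
Proof. intros H. unfold sumZ. replace (Z.to_nat (b - a + 1)) with 0%nat by lia. reflexivity. Qed.

Lemma sumZ_first (a b : Z) (f : Z -> R) : (a <= b)%Z -> sumZ a b f = f a + sumZ (a + 1) b f.
Proof.
  intros H. unfold sumZ.
  replace (Z.to_nat (b - a + 1)) with (S (Z.to_nat (b - (a + 1) + 1))) by lia.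
  simpl. rewrite Z.add_0_r, <- seq_shift, map_map. do 2 f_equal.
  apply map_ext. intros k. f_equal. lia.
Qed.

Lemma sumZ_last (a b : Z) (f : Z -> R) : (a <= b)%Z -> sumZ a b f = sumZ a (b - 1) f + f b.
Proof.
  intros H. remember (Z.to_nat (b - a)) as n eqn:En. revert a H En.
  induction n as [|n IH]; intros a H En.
  - assert (a = b) as -> by lia.
    rewrite sumZ_first, !sumZ_empty by lia. lra.
  - rewrite (sumZ_first a b), (sumZ_first a (b - 1)), (IH (a + 1)%Z) by lia. lra.
Qed.

Lemma sumZ_le (a b : Z) (f g : Z -> R) :
  (forall i, (a <= i <= b)%Z -> f i <= g i) -> sumZ a b f <= sumZ a b g.
Proof.
  intros H. remember (Z.to_nat (b - a + 1)) as n eqn:En. revert a H En.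
  induction n as [|n IH]; intros a H En.
  - rewrite !sumZ_empty by lia. lra.
  - rewrite !(sumZ_first a b) by lia.
    apply Rplus_le_compat; [apply H; lia|]. apply IH; [|lia]. intros i Hi. apply H. lia.
Qed.

Lemma sumZ_ext (a b : Z) (f g : Z -> R) :
  (forall i, (a <= i <= b)%Z -> f i = g i) -> sumZ a b f = sumZ a b g.
Proof. intros H. apply Rle_antisym; apply sumZ_le; intros i Hi; rewrite H; auto; lra. Qed.

Lemma sumZ_lin (a b : Z) (f g : Z -> R) (c : R) :
  sumZ a b (fun i => f i + c * g i) = sumZ a b f + c * sumZ a b g.
Proof.
  remember (Z.to_nat (b - a + 1)) as n eqn:En. revert a En.
  induction n as [|n IH]; intros a En.
  - rewrite !sumZ_empty by lia. lra.
  - rewrite !(sumZ_first a b), IH by lia. lra.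
Qed.

Lemma sumZ_const0 (a b : Z) : sumZ a b (fun _ => 0) = 0.
Proof.
  transitivity (sumZ a b (fun i => 0 + -1 * 0)); [apply sumZ_ext; intros; ring|].
  rewrite sumZ_lin. ring_simplify. reflexivity.
Qed.

Lemma sumZ_nonneg (a b : Z) (f : Z -> R) :
  (forall i, (a <= i <= b)%Z -> 0 <= f i) -> 0 <= sumZ a b f.
Proof. intros H. rewrite <- (sumZ_const0 a b). now apply sumZ_le. Qed.

Lemma sumZ_shift (a b c : Z) (f : Z -> R) :
  sumZ a b (fun i => f (i + c)%Z) = sumZ (a + c) (b + c) f.
Proof.
  unfold sumZ. replace (b + c - (a + c) + 1)%Z with (b - a + 1)%Z by lia.
  f_equal. apply map_ext. intros k. f_equal. lia.
Qed.

Lemma sumZ_mono_r (a b b' : Z) (f : Z -> R) : (b <= b')%Z ->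
  (forall i, (a <= i <= b')%Z -> 0 <= f i) -> sumZ a b f <= sumZ a b' f.
Proof.
  intros H Hf. remember (Z.to_nat (b' - b)) as n eqn:En. revert b' H Hf En.
  induction n as [|n IH]; intros b' H Hf En.
  - replace b' with b by lia. lra.
  - destruct (Z_le_gt_dec a b') as [Hab|Hab].
    + rewrite (sumZ_last a b') by lia. pose proof (Hf b' ltac:(lia)).
      enough (sumZ a b f <= sumZ a (b' - 1) f) by lra.
      apply IH; try lia. intros i Hi. apply Hf. lia.
    + rewrite !sumZ_empty by lia. lra.
Qed.

Lemma sumZ_mono_l (a a' b : Z) (f : Z -> R) : (a <= a')%Z ->
  (forall i, (a <= i <= b)%Z -> 0 <= f i) -> sumZ a' b f <= sumZ a b f.
Proof.
  intros H Hf. remember (Z.to_nat (a' - a)) as n eqn:En. revert a H Hf En.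
  induction n as [|n IH]; intros a H Hf En.
  - replace a' with a by lia. lra.
  - destruct (Z_le_gt_dec a b) as [Hab|Hab].
    + rewrite (sumZ_first a b) by lia. pose proof (Hf a ltac:(lia)).
      enough (sumZ a' b f <= sumZ (a + 1) b f) by lra.
      apply IH; try lia. intros i Hi. apply Hf. lia.
    + rewrite !sumZ_empty by lia. lra.
Qed.

(* [gp x = h x - h (x - 1)] to the right of 0 and [gm x = h x - h (x + 1)] to its left. *)
Lemma lyapunov_of_increments (a b gp gm : Z -> R) :
  (forall x, (1 <= x)%Z -> 0 <= gp x) -> (forall x, (x <= -1)%Z -> 0 <= gm x) ->
  (forall x, (1 <= x)%Z -> a x * gp (x + 1)%Z - b x * gp x <= 1) ->
  (forall x, (x <= -1)%Z -> b x * gm (x - 1)%Z - a x * gm x <= 1) ->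
  unbounded (fun J => sumZ 1 (Z.of_nat J) gp) ->
  unbounded (fun J => sumZ (- Z.of_nat J) (-1) gm) ->
  exists h C, lyapunov a b h C.
Proof.
  intros Hgp Hgm Lp Lm Up Um.
  (* At 0 the generator of [h] equals [a 0 * gp 1 + b 0 * gm (-1)], the one value that the
     conditions on the increments leave free. *)
  exists (fun x => sumZ 1 x gp + sumZ x (-1) gm), (1 + Rabs (a 0%Z * gp 1%Z + b 0%Z * gm (-1)%Z)).
  pose proof (Rabs_pos (a 0%Z * gp 1%Z + b 0%Z * gm (-1)%Z)) as P.
  assert (Np : forall x, 0 <= sumZ 1 x gp) by (intros x; apply sumZ_nonneg; intros; apply Hgp; lia).
  assert (Nm : forall x, 0 <= sumZ x (-1) gm) by (intros x; apply sumZ_nonneg; intros; apply Hgm; lia).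
  split; [lra|]. split; [|split].
  - intros x. specialize (Np x). specialize (Nm x). lra.
  - intros x. unfold gen.
    destruct (Z_le_gt_dec 1 x) as [H1|H1]; [|destruct (Z_le_gt_dec x (-1)) as [H2|H2]].
    + rewrite !(sumZ_empty _ (-1)) by lia. rewrite (sumZ_last 1 (x + 1)), (sumZ_last 1 x) by lia.
      replace (x + 1 - 1)%Z with x by lia. rewrite (sumZ_last 1 x) by lia.
      specialize (Lp x H1). lra.
    + rewrite !(sumZ_empty 1) by lia. rewrite (sumZ_first (x - 1) (-1)), (sumZ_first x (-1)) by lia.
      replace (x - 1 + 1)%Z with x by lia. rewrite (sumZ_first x (-1)) by lia.
      specialize (Lm x H2). lra.
    + assert (x = 0%Z) as -> by lia.
      replace (sumZ 1 (0 + 1) gp) with (gp 1%Z)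
        by (rewrite sumZ_first, sumZ_empty by lia; simpl; ring).
      replace (sumZ (0 - 1) (-1) gm) with (gm (-1)%Z)
        by (rewrite sumZ_first, sumZ_empty by lia; simpl; ring).
      rewrite !sumZ_empty by lia. simpl.
      pose proof (Rle_abs (a 0%Z * gp 1%Z + b 0%Z * gm (-1)%Z)). lra.
  - intros r. destruct (Up r) as [J1 H1]. destruct (Um r) as [J2 H2].
    exists (Z.of_nat (Nat.max J1 J2)). intros x Hx.
    destruct (Z_le_gt_dec 0 x).
    + assert (sumZ 1 (Z.of_nat J1) gp <= sumZ 1 x gp).
      { apply sumZ_mono_r; [lia|]. intros; apply Hgp; lia. }
      specialize (Nm x). lra.
    + assert (sumZ (- Z.of_nat J2) (-1) gm <= sumZ x (-1) gm).
      { apply sumZ_mono_l; [lia|]. intros; apply Hgm; lia. }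
      specialize (Np x). lra.
Qed.

(** * Products and the reversible measures *)

Lemma prodZ_empty (a b : Z) (f : Z -> R) : (b < a)%Z -> prodZ a b f = 1.
Proof. intros H. unfold prodZ. replace (Z.to_nat (b - a + 1)) with 0%nat by lia. reflexivity. Qed.

Lemma prodZ_first (a b : Z) (f : Z -> R) : (a <= b)%Z -> prodZ a b f = f a * prodZ (a + 1) b f.
Proof.
  intros H. unfold prodZ.
  replace (Z.to_nat (b - a + 1)) with (S (Z.to_nat (b - (a + 1) + 1))) by lia.
  simpl. rewrite Z.add_0_r, <- seq_shift, map_map. do 2 f_equal.
  apply map_ext. intros k. f_equal. lia.
Qed.

Lemma prodZ_last (a b : Z) (f : Z -> R) : (a <= b)%Z -> prodZ a b f = prodZ a (b - 1) f * f b.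
Proof.
  intros H. remember (Z.to_nat (b - a)) as n eqn:En. revert a H En.
  induction n as [|n IH]; intros a H En.
  - assert (a = b) as -> by lia.
    rewrite prodZ_first, !prodZ_empty by lia. lra.
  - rewrite (prodZ_first a b), (prodZ_first a (b - 1)), (IH (a + 1)%Z) by lia. lra.
Qed.

Lemma prodZ_shift (a b c : Z) (f : Z -> R) :
  prodZ a b (fun i => f (i + c)%Z) = prodZ (a + c) (b + c) f.
Proof.
  unfold prodZ. replace (b + c - (a + c) + 1)%Z with (b - a + 1)%Z by lia.
  f_equal. apply map_ext. intros k. f_equal. lia.
Qed.

(** The common shape of [piF] and [pihat]: both are instances by conversion, so one pair of step
    lemmas serves both detailed balance relations. *)
Definition twosided (u v : Z -> R) (x : Z) : R :=
  if (1 <=? x)%Z then prodZ 1 x u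
  else if (x =? 0)%Z then 1
  else prodZ 1 (- x) (fun i => v (x + i)%Z).

Lemma twosided_pos_step (u v : Z -> R) (x : Z) : (0 <= x)%Z ->
  twosided u v (x + 1) = twosided u v x * u (x + 1)%Z.
Proof.
  intros H. unfold twosided. rewrite (proj2 (Z.leb_le 1 (x + 1))) by lia.
  rewrite prodZ_last by lia. replace (x + 1 - 1)%Z with x by lia.
  destruct (Z.leb_spec 1 x); [auto|]. assert (x = 0%Z) as -> by lia.
  rewrite prodZ_empty by lia. reflexivity.
Qed.

Lemma twosided_neg_step (u v : Z -> R) (x : Z) : (x <= -1)%Z ->
  twosided u v x = v (x + 1)%Z * twosided u v (x + 1).
Proof.
  intros H. unfold twosided. rewrite !(proj2 (Z.leb_gt 1 _)) by lia.
  rewrite (proj2 (Z.eqb_neq x 0)) by lia. rewrite prodZ_first by lia. f_equal.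
  destruct (Z.eqb_spec (x + 1) 0) as [E|E]; [apply prodZ_empty; lia|].
  replace (- x)%Z with (- (x + 1) + 1)%Z by lia.
  rewrite <- (prodZ_shift 1 (- (x + 1)) 1).
  unfold prodZ. f_equal. apply map_ext. intros k. f_equal. lia.
Qed.

Lemma inIb_mono (isZ : bool) (x y : Z) : (x <= y)%Z -> inIb isZ x = true -> inIb isZ y = true.
Proof. unfold inIb. destruct isZ; simpl; auto. intros; lia. Qed.

Lemma inIb_succ (isZ : bool) (x : Z) : inIb isZ x = true -> inIb isZ (x + 1) = true.
Proof. apply inIb_mono. lia. Qed.

Lemma inIb_nonneg (isZ : bool) (x : Z) : (0 <= x)%Z -> inIb isZ x = true.
Proof. unfold inIb. destruct isZ; simpl; auto. lia. Qed.

Section Rates.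
Variables (isZ : bool) (lam mu : Z -> R).
Hypothesis Hlam : forall x : Z, inIb isZ x = true -> 0 < lam x.
Hypothesis Hmu : forall x : Z, inIb isZ x = true -> (isZ = true \/ x <> 0%Z) -> 0 < mu x.

Lemma mu_succ_pos (x : Z) : inIb isZ x = true -> 0 < mu (x + 1)%Z.
Proof.
  intros H. apply Hmu; [now apply inIb_succ|].
  unfold inIb in H. apply orb_true_iff in H as [H|H]; [now left|right; lia].
Qed.

Lemma piF_step (x : Z) : inIb isZ x = true ->
  lam x * piF lam mu x = mu (x + 1)%Z * piF lam mu (x + 1).
Proof.
  intros H. pose proof (Hlam x H). pose proof (mu_succ_pos x H).
  assert (E : forall z, piF lam mu z =
    twosided (fun i => lam (i - 1)%Z / mu i) (fun j => mu j / lam (j - 1)%Z) z) by reflexivity.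
  destruct (Z_le_gt_dec 0 x) as [Hx|Hx].
  - rewrite (E (x + 1)%Z), twosided_pos_step, <- E by lia.
    replace (x + 1 - 1)%Z with x by lia. field. lra.
  - rewrite (E x), twosided_neg_step, <- E by lia.
    replace (x + 1 - 1)%Z with x by lia. field. lra.
Qed.

(** Detailed balance of the dual, with up-rate [mu (x + 1)] at [x] and down-rate [lam (x + 1)] at
    [x + 1]. *)
Lemma pihat_step (x : Z) : inIb isZ x = true ->
  pihat lam mu x * mu (x + 1)%Z = pihat lam mu (x + 1) * lam (x + 1)%Z.
Proof.
  intros H. pose proof (Hlam _ (inIb_succ isZ x H)). pose proof (mu_succ_pos x H).
  assert (E : forall z, pihat lam mu z =
    twosided (fun i => mu i / lam i) (fun j => lam j / mu j) z) by reflexivity.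
  destruct (Z_le_gt_dec 0 x) as [Hx|Hx].
  - rewrite (E (x + 1)%Z), twosided_pos_step, <- E by lia. field. lra.
  - rewrite (E x), twosided_neg_step, <- E by lia. field. lra.
Qed.

Lemma piF_pos (x : Z) : inIb isZ x = true -> 0 < piF lam mu x.
Proof.
  assert (Pp : forall n : nat, 0 < piF lam mu (Z.of_nat n)).
  { induction n as [|n IH]; [change (0 < 1); lra|].
    assert (Hi : inIb isZ (Z.of_nat n) = true) by (apply inIb_nonneg; lia).
    pose proof (piF_step _ Hi) as Hst. pose proof (Hlam _ Hi). pose proof (mu_succ_pos _ Hi).
    replace (Z.of_nat (S n)) with (Z.of_nat n + 1)%Z by lia.
    apply (Rmult_lt_reg_l (mu (Z.of_nat n + 1)%Z)); [auto|].
    rewrite Rmult_0_r, <- Hst. now apply Rmult_lt_0_compat. }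
  assert (Pm : forall n : nat, inIb isZ (- Z.of_nat n) = true -> 0 < piF lam mu (- Z.of_nat n)).
  { induction n as [|n IH]; intros Hi; [change (0 < 1); lra|].
    pose proof (piF_step _ Hi) as Hst. pose proof (Hlam _ Hi). pose proof (mu_succ_pos _ Hi).
    apply inIb_succ in Hi.
    replace (- Z.of_nat (S n) + 1)%Z with (- Z.of_nat n)%Z in * by lia.
    apply (Rmult_lt_reg_l (lam (- Z.of_nat (S n))%Z)); [auto|].
    rewrite Rmult_0_r, Hst. apply Rmult_lt_0_compat; auto. }
  intros H. destruct (Z_le_gt_dec 0 x).
  - replace x with (Z.of_nat (Z.to_nat x)) by lia. apply Pp.
  - replace x with (- Z.of_nat (Z.to_nat (- x)))%Z in * by lia. now apply Pm.
Qed.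

(** When [I] is [N], zero rates make the negative integers absorbing; for the dual, [-1] becomes the
    point where the chain is killed. *)
Definition extend (f : Z -> R) (x : Z) : R := if inIb isZ x then f x else 0.

Hypothesis Hmu0 : isZ = false -> mu 0%Z = 0.

Lemma extend_rates : rates (extend lam) (extend mu).
Proof.
  intros x. unfold extend. destruct (inIb isZ x) eqn:E; [|lra].
  pose proof (Hlam x E). split; [lra|].
  destruct (Z.eq_dec x 0) as [->|N].
  - destruct isZ eqn:EZ; [apply Rlt_le, Hmu; auto|]. rewrite Hmu0; auto; lra.
  - apply Rlt_le, Hmu; auto.
Qed.

(** The dual up-rate vanishes outside [I]; at [-1] this is the assumption [mu 0 = 0]. *)
Lemma extend_mu_succ (x : Z) : inIb isZ x = false -> extend mu (x + 1) = 0.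
Proof.
  intros [HZ Hx]%orb_false_iff. unfold extend, inIb. rewrite HZ. simpl.
  destruct (Z.leb_spec 0 (x + 1)); [|auto]. replace (x + 1)%Z with 0%Z by lia. auto.
Qed.

(** The increment of the scale function. By detailed balance [lam 0 * e] is [pihat] on [I]: duality
    exchanges scale and speed. *)
Let e (j : Z) : R := / (lam j * piF lam mu j).

Lemma e_pos (j : Z) : inIb isZ j = true -> 0 < e j.
Proof.
  intros H. apply Rinv_0_lt_compat. apply Rmult_lt_0_compat; [now apply Hlam|now apply piF_pos].
Qed.

(** [s] is where the inner sums start: 0 for [N] and 1 for [Z], following the boundary series. *)
Section RightIncrement.
Variable s : Z.
Hypothesis Hs : (0 <= s <= 1)%Z.

(** These are the increments of the double sum that solves [L h = 1] to the right of 0: both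
    coefficients reduce to [1 / piF x], and the two sums of [piF] differ by the term [piF x]. *)
Lemma primal_increment (x : Z) : (1 <= x)%Z ->
  extend lam x * (e (x + 1 - 1)%Z * sumZ s (x + 1 - 1) (piF lam mu))
  - extend mu x * (e (x - 1)%Z * sumZ s (x - 1) (piF lam mu)) <= 1.
Proof.
  intros H. replace (x + 1 - 1)%Z with x by lia. rewrite (sumZ_last s x) by lia.
  assert (Hx : inIb isZ x = true) by (apply inIb_nonneg; lia).
  assert (Hx1 : inIb isZ (x - 1) = true) by (apply inIb_nonneg; lia).
  unfold extend, e. rewrite Hx. pose proof (piF_step _ Hx1) as Hst.
  replace (x - 1 + 1)%Z with x in Hst by lia. rewrite Hst.
  pose proof (Hlam x Hx). pose proof (piF_pos x Hx). pose proof (mu_succ_pos _ Hx1) as Hm.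
  replace (x - 1 + 1)%Z with x in Hm by lia.
  right. field. lra.
Qed.

(** With scale and speed exchanged, both coefficients reduce to [1 / e x = lam x * piF x], and the
    two sums differ by [e x]. *)
Lemma dual_increment (x : Z) : (1 <= x)%Z ->
  extend mu (x + 1) * (piF lam mu (x + 1) * sumZ s (x + 1 - 1) e)
  - extend lam x * (piF lam mu x * sumZ s (x - 1) e) <= 1.
Proof.
  intros H. replace (x + 1 - 1)%Z with x by lia. rewrite (sumZ_last s x) by lia.
  assert (Hx : inIb isZ x = true) by (apply inIb_nonneg; lia).
  assert (Hx1 : inIb isZ (x + 1) = true) by (apply inIb_nonneg; lia).
  unfold extend. rewrite Hx, Hx1. pose proof (piF_step _ Hx) as Hst.
  rewrite <- Rmult_assoc, <- Hst.
  pose proof (Hlam x Hx). pose proof (piF_pos x Hx).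
  right. unfold e. field. lra.
Qed.

End RightIncrement.

(** On [N] the second boundary series is summed over [j] outside and [i > j] inside, while the dual
    Lyapunov function accumulates over [i]. After the interchange only pairs with [j > J] are added,
    whence an inequality. *)
Lemma exchange_sum (pi f : Z -> R) (J K : nat) :
  (forall x, (0 <= x)%Z -> 0 <= pi x) -> (forall x, (0 <= x)%Z -> 0 <= f x) ->
  sumZ 0 (Z.of_nat J) (fun j => f j * sumZ (j + 1) (Z.of_nat K) pi)
  <= sumZ 1 (Z.of_nat K) (fun i => pi i * sumZ 0 (i - 1) f).
Proof.
  intros Hpi Hf. induction K as [|K IH].
  - rewrite (sumZ_empty 1) by lia. rewrite <- (sumZ_const0 0 (Z.of_nat J)).
    apply sumZ_le. intros i Hi. rewrite sumZ_empty by lia. lra.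
  - rewrite (sumZ_last 1) by lia.
    replace (Z.of_nat (S K) - 1)%Z with (Z.of_nat K) by lia.
    (* The new term [pi (K + 1)] joins the inner sums of the indices [j <= K] only. *)
    set (g := fun j => if (j <=? Z.of_nat K)%Z then f j else 0).
    rewrite (sumZ_ext 0 _ _ (fun j => f j * sumZ (j + 1) (Z.of_nat K) pi
      + pi (Z.of_nat (S K)) * g j)).
    + rewrite sumZ_lin. apply Rplus_le_compat; [exact IH|].
      apply Rmult_le_compat_l; [apply Hpi; lia|].
      apply Rle_trans with (sumZ 0 (Z.max (Z.of_nat J) (Z.of_nat K)) g).
      * apply sumZ_mono_r; [lia|]. intros i Hi. unfold g.
        destruct (_ <=? _)%Z; [apply Hf; lia|lra].
      * right. generalize (Z.max_spec (Z.of_nat J) (Z.of_nat K)).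
        assert (Q : forall m : nat, sumZ 0 (Z.of_nat K + Z.of_nat m) g = sumZ 0 (Z.of_nat K) f).
        { induction m as [|m IHm].
          - rewrite Z.add_0_r. apply sumZ_ext. intros i Hi. unfold g.
            now rewrite (proj2 (Z.leb_le i _)) by lia.
          - rewrite sumZ_last by lia. unfold g at 2. rewrite (proj2 (Z.leb_gt _ _)) by lia.
            replace (Z.of_nat K + Z.of_nat (S m) - 1)%Z with (Z.of_nat K + Z.of_nat m)%Z by lia.
            rewrite IHm. ring. }
        intros _. rewrite <- (Q (Z.to_nat (Z.max (Z.of_nat J) (Z.of_nat K) - Z.of_nat K))).
        f_equal. lia.
    + intros j Hj. unfold g. destruct (Z.leb_spec j (Z.of_nat K)).
      * rewrite (sumZ_last (j + 1)) by lia.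
        replace (Z.of_nat (S K) - 1)%Z with (Z.of_nat K) by lia. ring.
      * rewrite !sumZ_empty by lia. ring.
Qed.

Lemma unbounded_shift (u v : nat -> R) (k : nat) :
  (forall J, u J <= v (J + k)%nat) -> unbounded u -> unbounded v.
Proof.
  intros H Hu M. destruct (Hu M) as [J HJ]. exists (J + k)%nat. specialize (H J). lra.
Qed.

Lemma unbounded_count : unbounded (fun J => sumZ (- Z.of_nat J) (-1) (fun _ => 1)).
Proof.
  intros M. destruct (INR_unbounded M) as [J HJ]. exists J.
  enough (E : sumZ (- Z.of_nat J) (-1) (fun _ => 1) = INR J) by lra.
  clear HJ. induction J as [|J IH]; [reflexivity|].
  rewrite sumZ_first, S_INR by lia.
  replace (- Z.of_nat (S J) + 1)%Z with (- Z.of_nat J)%Z by lia. rewrite IH. ring.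
Qed.

Hypothesis Hnat : natural_boundaries isZ lam mu.

Lemma piF_nonneg_ge0 (x : Z) : (0 <= x)%Z -> 0 <= piF lam mu x.
Proof. intros H. apply Rlt_le, piF_pos. now apply inIb_nonneg. Qed.

Lemma e_nonneg_ge0 (x : Z) : (0 <= x)%Z -> 0 <= e x.
Proof. intros H. apply Rlt_le, e_pos. now apply inIb_nonneg. Qed.

Lemma primal_lyapunov : exists h C, lyapunov (extend lam) (extend mu) h C.
Proof.
  pose proof Hnat as HN. unfold natural_boundaries in HN.
  destruct (Sumbool.sumbool_of_bool isZ) as [EZ|EZ]; rewrite EZ in HN; fold e in HN.
  - assert (HI : forall x, inIb isZ x = true) by (intros x; unfold inIb; now rewrite EZ).
    destruct HN as (H1 & _ & H3 & _).
    apply (lyapunov_of_increments _ _ (fun x => e (x - 1)%Z * sumZ 1 (x - 1) (piF lam mu))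
      (fun x => e x * sumZ (x + 1) (-1) (piF lam mu))).
    + intros x Hx. apply Rmult_le_pos; [apply e_nonneg_ge0; lia|].
      apply sumZ_nonneg. intros; apply piF_nonneg_ge0; lia.
    + intros x Hx. apply Rmult_le_pos; [apply Rlt_le, e_pos; rewrite EZ; auto|].
      apply sumZ_nonneg. intros; apply Rlt_le, piF_pos, HI.
    + intros x Hx. apply primal_increment; lia.
    + intros x Hx. rewrite (sumZ_first (x - 1 + 1)) by lia.
      replace (x - 1 + 1)%Z with x by lia.
      pose proof (piF_step (x - 1)%Z (HI _)) as Hst.
      replace (x - 1 + 1)%Z with x in Hst by lia.
      unfold extend, e. rewrite HI, Hst.
      pose proof (Hlam x (HI x)). pose proof (piF_pos x (HI x)).
      pose proof (mu_succ_pos (x - 1)%Z (HI _)) as Hm.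
      replace (x - 1 + 1)%Z with x in Hm by lia. right. field. lra.
    (* The increment at [x] carries the term of index [x - 1]; the term of index 0 has an empty
       inner sum. *)
    + apply (unbounded_shift _ _ 1) with (2 := H1). intros J.
      rewrite (sumZ_shift 1 _ (-1) (fun x => e x * sumZ 1 x (piF lam mu))).
      rewrite (sumZ_first (1 + -1)) by lia. rewrite (sumZ_empty 1 (1 + -1)) by lia.
      replace (Z.of_nat (J + 1) + -1)%Z with (Z.of_nat J) by lia.
      rewrite Rmult_0_r, Rplus_0_l. apply Rle_refl.
    + exact H3.
  - destruct HN as (H1 & _).
    (* Points left of 0 do not move, so any nonnegative increments with divergent sum serve
       there. *)
    apply (lyapunov_of_increments _ _ (fun x => e (x - 1)%Z * sumZ 0 (x - 1) (piF lam mu))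
      (fun x => 1)).
    + intros x Hx. apply Rmult_le_pos; [apply e_nonneg_ge0; lia|].
      apply sumZ_nonneg. intros; apply piF_nonneg_ge0; lia.
    + intros; lra.
    + intros x Hx. apply primal_increment; lia.
    + intros x Hx. unfold extend, inIb. rewrite EZ. simpl. rewrite (proj2 (Z.leb_gt 0 x)) by lia. lra.
    + apply (unbounded_shift _ _ 1) with (2 := H1). intros J.
      rewrite (sumZ_shift 1 _ (-1) (fun x => e x * sumZ 0 x (piF lam mu))).
      replace (Z.of_nat (J + 1) + -1)%Z with (Z.of_nat J) by lia. apply Rle_refl.
    + apply unbounded_count.
Qed.

(** The dual has [piF] as scale and [e] as speed, so here the other half of the boundary conditions
    enters. *)
Lemma dual_lyapunov : exists h C, lyapunov (fun z => extend mu (z + 1)%Z) (extend lam) h C.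
Proof.
  pose proof Hnat as HN. unfold natural_boundaries in HN.
  destruct (Sumbool.sumbool_of_bool isZ) as [EZ|EZ]; rewrite EZ in HN; fold e in HN.
  - assert (HI : forall x, inIb isZ x = true) by (intros x; unfold inIb; now rewrite EZ).
    destruct HN as (_ & H2 & _ & H4).
    apply (lyapunov_of_increments _ _ (fun x => piF lam mu x * sumZ 1 (x - 1) e)
      (fun x => piF lam mu (x + 1) * sumZ (x + 1) (-1) e)).
    + intros x Hx. apply Rmult_le_pos; [apply piF_nonneg_ge0; lia|].
      apply sumZ_nonneg. intros; apply e_nonneg_ge0; lia.
    + intros x Hx. apply Rmult_le_pos; [apply Rlt_le, piF_pos; rewrite EZ; auto|].
      apply sumZ_nonneg. intros; apply Rlt_le, e_pos, HI.
    + intros x Hx. apply dual_increment; lia.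
    + intros x Hx. replace (x - 1 + 1)%Z with x by lia. rewrite (sumZ_first x) by lia.
      unfold extend. rewrite !HI. pose proof (piF_step x (HI x)) as Hst.
      rewrite <- (Rmult_assoc (mu _)), <- Hst.
      pose proof (Hlam x (HI x)). pose proof (piF_pos x (HI x)).
      right. unfold e at 1. field. lra.
    + exact H2.
    + apply (unbounded_shift _ _ 1) with (2 := H4). intros J.
      rewrite (sumZ_shift _ (-1) 1 (fun x => piF lam mu x * sumZ x (-1) e)).
      rewrite (sumZ_last _ (-1 + 1)) by lia. rewrite (sumZ_empty (-1 + 1)) by lia.
      replace (- Z.of_nat (J + 1) + 1)%Z with (- Z.of_nat J)%Z by lia.
      replace (-1 + 1 - 1)%Z with (-1)%Z by lia.
      rewrite Rmult_0_r, Rplus_0_r. apply Rle_refl.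
  - destruct HN as (_ & H2).
    apply (lyapunov_of_increments _ _ (fun x => piF lam mu x * sumZ 0 (x - 1) e)
      (fun x => 1)).
    + intros x Hx. apply Rmult_le_pos; [apply piF_nonneg_ge0; lia|].
      apply sumZ_nonneg. intros; apply e_nonneg_ge0; lia.
    + intros; lra.
    + intros x Hx. apply dual_increment; lia.
    + intros x Hx. rewrite extend_mu_succ by (unfold inIb; rewrite EZ; simpl; lia).
      unfold extend, inIb. rewrite EZ. simpl. rewrite (proj2 (Z.leb_gt 0 x)) by lia. lra.
    + intros M. destruct (H2 M) as [J [K HJK]]. exists K.
      eapply Rlt_le_trans; [exact HJK|].
      apply (exchange_sum (piF lam mu) e); [apply piF_nonneg_ge0|apply e_nonneg_ge0].
    + apply unbounded_count.
Qed.

End Rates.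

(** * Determinants *)

Module Determinant.
Import ssreflect ssrfun ssrbool eqtype ssrnat seq choice fintype bigop ssralg matrix.
Import GRing.Theory Rstruct.
Local Open Scope ring_scope.

Lemma fold_sumE (F : nat -> R) (m n : nat) :
  fold_right Rplus 0 (List.map F (List.seq m n)) = \sum_(m <= j < m + n) F j.
Proof.
elim: n m => [|n IHn] m /=; first by rewrite addn0 big_geq.
by rewrite IHn [RHS]big_ltn ?addnS ?ltnS ?leq_addr // addSn.
Qed.

(** Both sides expand along row 0; the index map [if k < j then k else S k] is [bump] of
    mathcomp. *)
Lemma detE (n : nat) (M : nat -> nat -> R) :
  det n M = \det (\matrix_(i < n, j < n) M i j).
Proof.
elim: n M => [|n IHn] M; first by rewrite det_mx00.
rewrite (expand_det_row _ ord0).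
transitivity (\sum_(j < n.+1)
  M 0%N j * ((-1) ^+ j * det n (fun i k => M i.+1 (if Nat.ltb k j then k else k.+1)))).
  rewrite -(big_mkord xpredT (fun j => M 0%N j *
    ((-1) ^+ j * det n (fun i k => M i.+1 (if Nat.ltb k j then k else k.+1))))).
  rewrite -[RHS](fold_sumE _ 0 n.+1).
  apply: (f_equal (fold_right Rplus 0)); apply: map_ext => j.
  by rewrite RpowE !RmultE mulrCA mulrA.
apply: eq_bigr => j _; rewrite mxE /cofactor add0n IHn; congr (_ * (_ * \det _)).
apply/matrixP => i k; rewrite !mxE /= /bump.
have -> : Nat.ltb k j = (k < j)%N by apply/idP/idP => [/Nat.ltb_lt/ltP|/ltP/Nat.ltb_lt].
by rewrite ltnNge; case: (j <= k)%N.
Qed.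

Lemma det_ext (n : nat) (M N : nat -> nat -> R) :
  (forall i j, lt i n -> lt j n -> M i j = N i j) -> det n M = det n N.
Proof.
move=> H; rewrite !detE; congr (\det _); apply/matrixP => i j; rewrite !mxE.
by apply: H; apply/ltP.
Qed.

Lemma det_transpose (n : nat) (M : nat -> nat -> R) : det n (fun i j => M j i) = det n M.
Proof.
rewrite !detE -det_tr; congr (\det _); by apply/matrixP => i j; rewrite !mxE.
Qed.

Lemma det_column_linear (n c : nat) (M : nat -> nat -> R) (f g : nat -> R) (r s : R) :
  lt c n ->
  det n (fun i j => if Nat.eqb j c then Rplus (Rmult r (f i)) (Rmult s (g i)) else M i j) =
  Rplus (Rmult r (det n (fun i j => if Nat.eqb j c then f i else M i j)))
    (Rmult s (det n (fun i j => if Nat.eqb j c then g i else M i j))).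
Proof.
(* Transposed because [determinant_multilinear] is about rows. *)
move=> /ltP ltcn; rewrite !detE -[LHS]det_tr -(det_tr (\matrix_(i, j) (if _ then f i else _))).
rewrite -(det_tr (\matrix_(i, j) (if _ then g i else _))).
have neq (k : 'I_n.-1) : Nat.eqb (lift (Ordinal ltcn) k) c = false.
  apply/Nat.eqb_neq => E; have /eqP := neq_lift (Ordinal ltcn) k; apply.
  by apply/val_inj.
apply: (determinant_multilinear (i0 := Ordinal ltcn)).
- by apply/rowP => j; rewrite !mxE /= Nat.eqb_refl.
- by apply/matrixP => i j; rewrite !mxE neq.
- by apply/matrixP => i j; rewrite !mxE neq.
Qed.

(** Multiplying by [1 - shift] on the right takes differences of columns, on the left differences of
    rows; being unit triangular it leaves determinants unchanged. *)
Local Definition shift (n : nat) : 'M[R]_n := \matrix_(i, j) (i.+1 == j)%:R.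

Lemma det_one_minus_shift (n : nat) : \det (1%:M - shift n) = 1.
Proof.
rewrite -det_tr det_trig.
  apply: big1 => i _; rewrite !mxE eqxx; have -> : (i.+1 == i) = false by rewrite gtn_eqF.
  by rewrite subr0.
apply/is_trig_mxP => i j ltij; rewrite !mxE.
have -> : (j == i) = false by apply/eqP => E; rewrite E ltnn in ltij.
have -> : (j.+1 == i) = false by rewrite gtn_eqF // ltnW.
by rewrite subr0.
Qed.

Lemma det_column_differences (n : nat) (M : nat -> nat -> R) :
  det n (fun i j => match j with O => M i O | S k => Rminus (M i j) (M i k) end) = det n M.
Proof.
rewrite !detE -[RHS]mulr1 -(det_one_minus_shift n) -det_mulmx; congr (\det _).
apply/matrixP => i j; rewrite mulmxBr mulmx1 !mxE.
case: j => [[|k] ltj] /=.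
  rewrite big1 ?subr0 // => l _; by rewrite !mxE mulr0.
have ltk : (k < n)%N by exact: ltnW.
rewrite RminusE (bigD1 (Ordinal ltk)) //= !mxE eqxx mulr1 big1 ?addr0 // => l neq.
rewrite !mxE /= eqSS; have -> : (l == k :> nat) = false; last by rewrite mulr0.
by apply/negbTE.
Qed.

Lemma det_row_differences (n : nat) (M : nat -> nat -> R) :
  det n (fun i j => if Nat.ltb (S i) n then Rminus (M i j) (M (S i) j) else M i j) = det n M.
Proof.
rewrite !detE -[RHS]mul1r -(det_one_minus_shift n) -det_mulmx; congr (\det _).
apply/matrixP => i j; rewrite mulmxBl mul1mx !mxE.
case: Nat.ltb_spec => [/ltP lti|/leP lti].
  rewrite (bigD1 (Ordinal lti)) //= !mxE eqxx mul1r big1 ?addr0 // => l neq.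
  rewrite !mxE; have -> : (i.+1 == l) = false; last by rewrite mul0r.
  by apply/negbTE; rewrite eq_sym.
rewrite big1 ?subr0 // => l _; rewrite !mxE.
have -> : (i.+1 == l) = false; last by rewrite mul0r.
by rewrite gtn_eqF // (leq_trans (ltn_ord l)).
Qed.

(** Meant for the column of ones given by honesty, which row differences turn into this unit
    column. *)
Lemma det_last_column_unit (n : nat) (M : nat -> nat -> R) :
  (forall i, lt i n -> M i n = 0) -> M n n = 1 -> det n.+1 M = det n M.
Proof.
move=> H0 H1; rewrite !detE (expand_det_col _ ord_max) (bigD1 ord_max) //= big1 ?addr0.
  rewrite mxE H1 mul1r /cofactor -signr_odd addnn odd_double expr0 mul1r.
  by congr (\det _); apply/matrixP => i j; rewrite !mxE !lift_max.
move=> i neq; rewrite mxE H0 ?mul0r //; apply/ltP.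
by rewrite ltn_neqAle -ltnS ltn_ord andbT; apply: contra neq => /eqP E; apply/eqP/val_inj.
Qed.

End Determinant.

Import Determinant.

(** * Determinants summed over interlacing configurations *)

Lemma sumL_cons {A : Type} (l : list A) (f : A -> R) (x : A) : sumL (x :: l) f = f x + sumL l f.
Proof. reflexivity. Qed.

Lemma sumL_ext {A : Type} (l : list A) (f g : A -> R) :
  (forall x, In x l -> f x = g x) -> sumL l f = sumL l g.
Proof. intros H. unfold sumL. f_equal. now apply map_ext_in. Qed.

Lemma sumL_app {A : Type} (l l' : list A) (f : A -> R) : sumL (l ++ l') f = sumL l f + sumL l' f.
Proof.
  induction l as [|x l IH]; simpl app; [unfold sumL at 2; simpl; ring|].
  rewrite !sumL_cons, IH. ring.
Qed.

Lemma sumL_map {A B : Type} (l : list A) (g : A -> B) (f : B -> R) :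
  sumL (map g l) f = sumL l (fun x => f (g x)).
Proof. unfold sumL. now rewrite map_map. Qed.

Lemma sumL_flat_map {A B : Type} (l : list A) (g : A -> list B) (f : B -> R) :
  sumL (flat_map g l) f = sumL l (fun x => sumL (g x) f).
Proof.
  induction l as [|x l IH]; [reflexivity|]. simpl flat_map. now rewrite sumL_app, IH.
Qed.

Lemma sumL_scal {A : Type} (l : list A) (f : A -> R) (r : R) :
  sumL l (fun x => r * f x) = r * sumL l f.
Proof.
  induction l as [|x l IH]; [unfold sumL; simpl; ring|]. rewrite !sumL_cons, IH. ring.
Qed.

Lemma det_laplace (n : nat) (M : nat -> nat -> R) :
  det (S n) M = sumL (seq 0 (S n)) (fun j => (-1) ^ j * M 0%nat j *
    det n (fun i k => M (S i) (if Nat.ltb k j then k else S k))).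
Proof. reflexivity. Qed.

Lemma det_column_sum {A : Type} (n c : nat) (D : nat -> nat -> R) (b : A -> bool)
  (M : nat -> A -> R) (l : list A) : (c < n)%nat ->
  det n (fun i j => if Nat.eqb j c then sumL l (fun z => if b z then M i z else 0) else D i j)
  = sumL l (fun z => if b z then det n (fun i j => if Nat.eqb j c then M i z else D i j) else 0).
Proof.
  intros Hc. induction l as [|z l IH].
  - rewrite (det_ext n _ (fun i j => if Nat.eqb j c then 0 * 0 + 0 * 0 else D i j)).
    + rewrite (det_column_linear n c D (fun _ => 0) (fun _ => 0)) by auto.
      unfold sumL; simpl; ring.
    + intros i j _ _. destruct (Nat.eqb j c); unfold sumL; simpl; ring.
  - rewrite sumL_cons, <- IH.
    rewrite (det_ext n _ (fun i j => if Nat.eqb j c then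
      (if b z then 1 else 0) * M i z + 1 * sumL l (fun z => if b z then M i z else 0) else D i j)).
    + rewrite (det_column_linear n c D (fun i => M i z)) by auto. destruct (b z); ring.
    + intros i j _ _. destruct (Nat.eqb j c); auto. rewrite sumL_cons. destruct (b z); ring.
Qed.

(** The first [d] columns are already settled in [D], the other [m] are still summed over the tuple.
    Only column [d] depends on the head of the tuple, so linearity in that column moves its sum
    inside. *)
Lemma box_sum_det_aux (N : nat) (c : nat -> Z -> bool) (M : nat -> Z -> R) (n m d : nat)
  (D : nat -> nat -> R) : n = (d + m)%nat ->
  sumL (box m N) (fun z => if forallb (fun j => c (d + j)%nat (nthZ j z)) (seq 0 m)
    then det n (fun i j => if Nat.ltb j d then D i j else M i (nthZ (j - d) z)) else 0)
  = det n (fun i j => if Nat.ltb j d then D i j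
      else sumL (zrange N) (fun w => if c j w then M i w else 0)).
Proof.
  revert d D. induction m as [|m IH]; intros d D Hn.
  - simpl box. rewrite sumL_cons. unfold sumL at 1; simpl. rewrite Rplus_0_r.
    apply det_ext. intros i j _ Hj. rewrite (proj2 (Nat.ltb_lt j d)) by lia. reflexivity.
  - simpl box. rewrite sumL_flat_map.
    set (col := fun i j => if Nat.ltb j (S d) then D i j
      else sumL (zrange N) (fun w => if c j w then M i w else 0)).
    transitivity (det n (fun i j => if Nat.eqb j d
      then sumL (zrange N) (fun z => if c d z then M i z else 0) else col i j)).
    + rewrite det_column_sum by lia. apply sumL_ext. intros z _. rewrite sumL_map.
      destruct (c d z) eqn:E.
      * rewrite <- (det_ext n (fun i j => if Nat.ltb j (S d)
          then (if Nat.eqb j d then M i z else D i j)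
          else sumL (zrange N) (fun w => if c j w then M i w else 0))).
        -- rewrite <- IH by lia. apply sumL_ext. intros r _.
           simpl seq. simpl forallb. rewrite Nat.add_0_r.
           change (nthZ 0 (z :: r)) with z. rewrite E. simpl andb.
           rewrite <- seq_shift.
           assert (Eb : forallb (fun j => c (d + j)%nat (nthZ j (z :: r))) (map S (seq 0 m))
             = forallb (fun j => c (S (d + j)) (nthZ j r)) (seq 0 m)).
           { generalize (seq 0 m). induction l as [|k l IHl]; [reflexivity|].
             simpl. rewrite <- plus_n_Sm. simpl in IHl. now rewrite IHl. }
           rewrite Eb. clear Eb. simpl (S d + _)%nat.
           destruct (forallb (fun j => c (S (d + j)) (nthZ j r)) (seq 0 m)); [|reflexivity].
           apply det_ext. intros i j _ _.
           destruct (Nat.ltb_spec j d), (Nat.ltb_spec j (S d)); try lia.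
           ++ now rewrite (proj2 (Nat.eqb_neq j d)) by lia.
           ++ assert (j = d) as -> by lia. now rewrite Nat.eqb_refl, Nat.sub_diag.
           ++ replace (j - d)%nat with (S (j - S d)) by lia. reflexivity.
        -- intros i j _ _. unfold col. destruct (Nat.eqb_spec j d) as [->|]; auto.
           now rewrite (proj2 (Nat.ltb_lt d (S d))) by lia.
      * transitivity (sumL (box m N) (fun _ => 0 * 0)).
        -- apply sumL_ext. intros r _. simpl seq. simpl forallb. rewrite Nat.add_0_r.
           change (nthZ 0 (z :: r)) with z. rewrite E. simpl. ring.
        -- rewrite sumL_scal. ring.
    + apply det_ext. intros i j _ _. unfold col.
      destruct (Nat.eqb_spec j d) as [->|Hj].
      * now rewrite Nat.ltb_irrefl.
      * destruct (Nat.ltb_spec j d), (Nat.ltb_spec j (S d)); try lia; reflexivity.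
Qed.

(** The constraint must be a conjunction of conditions on single coordinates; the interlacing lemmas
    below bring both relations, in either argument, to this form. *)
Lemma box_sum_det (N n : nat) (c : nat -> Z -> bool) (M : nat -> Z -> R) :
  sumL (box n N) (fun z => if forallb (fun j => c j (nthZ j z)) (seq 0 n)
    then det n (fun i j => M i (nthZ j z)) else 0)
  = det n (fun i j => sumL (zrange N) (fun w => if c j w then M i w else 0)).
Proof.
  etransitivity; [|exact (box_sum_det_aux N c M n n 0 (fun _ _ => 0) eq_refl)].
  apply sumL_ext. intros z _. destruct (forallb _ _); [|reflexivity].
  apply det_ext. intros i j _ _. simpl. now rewrite Nat.sub_0_r.
Qed.

Lemma prodL_det (w : Z -> R) (z : list Z) (M : nat -> nat -> R) :
  det (length z) (fun i j => w (nthZ i z) * M i j) = prodL w z * det (length z) M.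
Proof.
  revert M. induction z as [|x z IH]; intros M; [unfold prodL; simpl; ring|].
  simpl length. rewrite !det_laplace.
  change (prodL w (x :: z)) with (w x * prodL w z). rewrite <- sumL_scal.
  apply sumL_ext. intros j _.
  rewrite <- (det_ext _ (fun i k => w (nthZ i z) * M (S i) (if Nat.ltb k j then k else S k)))
    by reflexivity.
  rewrite (IH (fun i k => M (S i) (if Nat.ltb k j then k else S k))).
  change (nthZ 0 (x :: z)) with x. ring.
Qed.

Lemma det_cv (n : nat) (E : nat -> nat -> nat -> R) (l : nat -> nat -> R) :
  (forall i j, (i < n)%nat -> (j < n)%nat -> is_lim_seq (fun N => E N i j) (l i j)) ->
  is_lim_seq (fun N => det n (E N)) (det n l).
Proof.
  revert E l. induction n as [|n IH]; intros E l H; [apply is_lim_seq_const|].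
  rewrite det_laplace. apply is_lim_seq_ext with (1 := fun N => eq_sym (det_laplace n (E N))).
  assert (Hin : forall j, In j (seq 0 (S n)) -> (j < S n)%nat)
    by (intros j Hj; apply in_seq in Hj; lia).
  revert Hin. generalize (seq 0 (S n)). induction l0 as [|j s IHs]; intros Hin.
  - apply is_lim_seq_const.
  - rewrite sumL_cons. apply is_lim_seq_ext with (1 := fun N => eq_sym (sumL_cons _ _ _)).
    apply is_lim_seq_plus'; [|apply IHs; intros; apply Hin; now right].
    assert (Hj : (j < S n)%nat) by (apply Hin; now left).
    apply is_lim_seq_mult'.
    + apply is_lim_seq_mult'; [apply is_lim_seq_const|]. apply H; lia.
    + apply (IH (fun N i k => E N (S i) (if Nat.ltb k j then k else S k))
        (fun i k => l (S i) (if Nat.ltb k j then k else S k))).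
      intros i k Hi Hk. destruct (Nat.ltb_spec k j); apply H; lia.
Qed.

(** * Interlacing as independent conditions on the coordinates *)

Lemma incr_spec (l : list Z) : incr l = true <->
  forall i, (S i < length l)%nat -> (nthZ i l < nthZ (S i) l)%Z.
Proof.
  induction l as [|x [|y l] IH].
  - simpl. split; [intros _ i Hi; lia|auto].
  - simpl. split; [intros _ i Hi; lia|auto].
  - change (incr (x :: y :: l)) with ((x <? y)%Z && incr (y :: l)).
    rewrite andb_true_iff, IH, Z.ltb_lt. split.
    + intros [Hxy H] [|i] Hi; [exact Hxy|]. apply (H i). simpl in *. lia.
    + intros H. split; [apply (H 0%nat); simpl; lia|].
      intros i Hi. apply (H (S i)). simpl in *. lia.
Qed.

Lemma inW_spec (isZ : bool) (n : nat) (x : list Z) : inW isZ n x = true <->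
  length x = n /\ (forall i, (i < n)%nat -> inIb isZ (nthZ i x) = true) /\
  forall i, (S i < n)%nat -> (nthZ i x < nthZ (S i) x)%Z.
Proof.
  unfold inW. rewrite !andb_true_iff, Nat.eqb_eq, incr_spec, forallb_forall. split.
  - intros [[<- H] H']. split; [auto|]. split; [|auto].
    intros i Hi. apply H. now apply nth_In.
  - intros [<- [H H']]. split; [split; [auto|]|auto].
    intros z Hz. destruct (In_nth _ _ 0%Z Hz) as [i [Hi <-]]. now apply H.
Qed.

Lemma forallb_seq (f : nat -> bool) (n : nat) :
  forallb f (seq 0 n) = true <-> forall i, (i < n)%nat -> f i = true.
Proof.
  rewrite forallb_forall. split; intros H i Hi; apply H; [apply in_seq; lia|].
  apply in_seq in Hi; lia.
Qed.

Lemma in_box_length (m N : nat) (z : list Z) : In z (box m N) -> length z = m.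
Proof.
  revert z. induction m as [|m IH]; intros z H; simpl in H.
  - destruct H as [<-|[]]. reflexivity.
  - apply in_flat_map in H. destruct H as [w [_ H]]. apply in_map_iff in H.
    destruct H as [r [<- Hr]]. simpl. f_equal. auto.
Qed.

Section Interlacing.
Variables (isZ : bool) (n : nat) (x y z : list Z).

(** The half-open interval from [y_(j-1)], excluded, to [y_j], included, with no lower end within
    [I] at [j = 0] and no upper end at [j = n]. For increasing [y] the [n + 1] cells partition
    [I]. *)
Definition cell_up (j : nat) (w : Z) : bool :=
  inIb isZ w && (negb (Nat.ltb j n) || (w <=? nthZ j y)%Z)
    && (Nat.eqb j 0 || (nthZ (j - 1) y <? w)%Z).

Definition cell_between (j : nat) (w : Z) : bool :=
  (nthZ j x <=? w)%Z && (w <? nthZ (S j) x)%Z.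

Definition cell_right (j : nat) (w : Z) : bool :=
  (nthZ j y <=? w)%Z && (negb (Nat.ltb (S j) n) || (w <? nthZ (S j) y)%Z).

(** Consecutive cells are separated by a coordinate of [y], so the separate conditions already force
    [z] to increase. *)
Lemma interlace_up : inW isZ n y = true -> length z = S n ->
  inW isZ (S n) z && in_Wnn1 isZ n z y = forallb (fun j => cell_up j (nthZ j z)) (seq 0 (S n)).
Proof.
  intros Hy Hz. apply eq_true_iff_eq. unfold in_Wnn1. rewrite Hy.
  rewrite andb_true_l, andb_true_iff, inW_spec, !forallb_seq. split.
  - intros [[_ [H1 H2]] H3] j Hj. unfold cell_up. rewrite H1 by auto. simpl andb.
    apply andb_true_iff. split; apply orb_true_iff.
    + destruct (Nat.ltb_spec j n) as [Hjn|]; [right|now left].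
      specialize (H3 j Hjn). apply andb_true_iff in H3. tauto.
    + destruct j as [|j]; [now left|right]. simpl. rewrite Nat.sub_0_r.
      specialize (H3 j ltac:(lia)). apply andb_true_iff in H3. tauto.
  - intros H.
    assert (H1 : forall i, (i < n)%nat -> (nthZ i z <= nthZ i y)%Z).
    { intros i Hi. specialize (H i ltac:(lia)). unfold cell_up in H.
      rewrite (proj2 (Nat.ltb_lt i n)) in H by auto. simpl in H. lia. }
    assert (H2 : forall i, (i < n)%nat -> (nthZ i y < nthZ (S i) z)%Z).
    { intros i Hi. specialize (H (S i) ltac:(lia)). unfold cell_up in H.
      replace (S i - 1)%nat with i in H by lia. simpl Nat.eqb in H. lia. }
    split; [split; [auto|split]|].
    + intros i Hi. specialize (H i Hi). unfold cell_up in H.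
      now apply andb_true_iff in H as [[H _]%andb_true_iff _].
    + intros i Hi. specialize (H1 i ltac:(lia)). specialize (H2 i ltac:(lia)). lia.
    + intros i Hi. specialize (H1 i Hi). specialize (H2 i Hi). lia.
Qed.

Lemma interlace_between : inW isZ (S n) x = true -> length z = n ->
  in_Wnn1 isZ n x z = forallb (fun j => cell_between j (nthZ j z)) (seq 0 n).
Proof.
  intros Hx Hz. apply inW_spec in Hx. destruct Hx as (_ & Hx & _).
  apply eq_true_iff_eq. unfold in_Wnn1, cell_between.
  rewrite andb_true_iff, inW_spec, !forallb_seq. split; [tauto|].
  intros H. split; [split; [auto|split]|auto].
  - intros i Hi. apply inIb_mono with (nthZ i x); [|apply Hx; lia]. specialize (H i Hi). lia.
  - intros i Hi. pose proof (H i ltac:(lia)). pose proof (H (S i) Hi). lia.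
Qed.

Lemma interlace_right : inW isZ n y = true -> length z = n ->
  inW isZ n z && in_Wnn isZ n z y = forallb (fun j => cell_right j (nthZ j z)) (seq 0 n).
Proof.
  intros Hy Hz. apply eq_true_iff_eq. unfold in_Wnn. rewrite Hy.
  apply inW_spec in Hy. destruct Hy as (_ & Hy & _).
  rewrite andb_true_l, !andb_true_iff, inW_spec, !forallb_seq. unfold cell_right. split.
  - intros [_ [H1 H2]] j Hj. rewrite H1 by auto. simpl andb. apply orb_true_iff.
    destruct (Nat.ltb_spec (S j) n); [right; apply H2; lia|now left].
  - intros H.
    assert (H1 : forall i, (S i < n)%nat -> (nthZ i z < nthZ (S i) y)%Z).
    { intros i Hi. specialize (H i ltac:(lia)).
      rewrite (proj2 (Nat.ltb_lt (S i) n)) in H by auto. simpl negb in H. lia. }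
    split; [split; [auto|split]|split].
    + intros i Hi. apply inIb_mono with (nthZ i y); auto. specialize (H i Hi). lia.
    + intros i Hi. specialize (H1 i Hi). pose proof (H (S i) Hi). lia.
    + intros i Hi. specialize (H i Hi). lia.
    + intros i Hi. specialize (H1 i ltac:(lia)). lia.
Qed.

(* The coordinates of [z] in [W^{n,n}(y)] range over the first [n] cells of [interlace_up]. *)
Lemma interlace_left : length z = n ->
  in_Wnn isZ n y z = forallb (fun j => cell_up j (nthZ j z)) (seq 0 n).
Proof.
  intros Hz. apply eq_true_iff_eq. unfold in_Wnn.
  rewrite !andb_true_iff, inW_spec, !forallb_seq. split.
  - intros [[[_ [H0 _]] H1] H2] j Hj. unfold cell_up. rewrite H0 by auto. simpl andb.
    apply andb_true_iff. split; apply orb_true_iff.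
    + right. apply H1; auto.
    + destruct j as [|j]; [now left|right]. simpl. rewrite Nat.sub_0_r. apply H2; lia.
  - intros H.
    assert (H1 : forall i, (i < n)%nat -> (nthZ i z <= nthZ i y)%Z).
    { intros i Hi. specialize (H i ltac:(lia)). unfold cell_up in H.
      rewrite (proj2 (Nat.ltb_lt i n)) in H by auto. simpl in H. lia. }
    assert (H2 : forall i, (S i < n)%nat -> (nthZ i y < nthZ (S i) z)%Z).
    { intros i Hi. specialize (H (S i) ltac:(lia)). unfold cell_up in H.
      replace (S i - 1)%nat with i in H by lia. simpl Nat.eqb in H. lia. }
    split; [split; [split; [auto|split]|]|].
    + intros i Hi. specialize (H i Hi). unfold cell_up in H.
      now apply andb_true_iff in H as [[H _]%andb_true_iff _].
    + intros i Hi. specialize (H1 i ltac:(lia)). specialize (H2 i ltac:(lia)). lia.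
    + intros i Hi. specialize (H1 i Hi). lia.
    + intros i Hi. specialize (H2 i ltac:(lia)). lia.
Qed.

End Interlacing.

(** * Intertwining *)

Section Intertwining.
Variables (isZ : bool) (lam mu : Z -> R).
Hypothesis Hlam : forall x : Z, inIb isZ x = true -> 0 < lam x.
Hypothesis Hmu : forall x : Z, inIb isZ x = true -> (isZ = true \/ x <> 0%Z) -> 0 < mu x.
Hypothesis Hmu0 : isZ = false -> mu 0%Z = 0.
Hypothesis Hnat : natural_boundaries isZ lam mu.
Variables p ph : R -> Z -> Z -> R.
Hypothesis Hp : transition_function isZ lam mu p.
Hypothesis Hph : transition_function isZ (fun x => mu (x + 1)%Z) lam ph.
Variable t : R.
Hypothesis Ht : 0 <= t.

Let a := extend isZ lam.
Let b := extend isZ mu.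
Let a' := fun z => b (z + 1)%Z.

(** The probability of being at or below [y] at time [t] from the start [x]; both limits are written
    through it. *)
Let cdf (x y : Z) : R := semi a b t (indic (fun z => z <=? y)%Z) x.

Lemma dual_rates : rates a' a.
Proof.
  intros z. destruct (extend_rates isZ lam mu Hlam Hmu Hmu0 z).
  destruct (extend_rates isZ lam mu Hlam Hmu Hmu0 (z + 1)%Z). split; assumption.
Qed.

Lemma dual_absorbing (x : Z) : inIb isZ x = false -> a' x = 0 /\ a x = 0.
Proof.
  intros H. split; [now apply extend_mu_succ|]. unfold a, extend. now rewrite H.
Qed.

Lemma primal_absorbing (x : Z) : inIb isZ x = false -> a x = 0 /\ b x = 0.
Proof. intros H. unfold a, b, extend. now rewrite H. Qed.

Lemma primal_semi (x y : Z) : inIb isZ x = true -> inIb isZ y = true ->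
  p t x y = semi a b t (delta y) x.
Proof.
  intros Hx Hy. destruct (primal_lyapunov isZ lam mu Hlam Hmu Hnat) as [h [C HL]].
  pose proof (extend_rates isZ lam mu Hlam Hmu Hmu0) as Hab.
  apply (transition_function_semi a b h C Hab HL isZ lam mu); auto using primal_absorbing.
  intros z Hz. unfold a, b, extend. now rewrite Hz.
Qed.

Lemma dual_semi (x y : Z) : inIb isZ x = true -> inIb isZ y = true ->
  ph t x y = semi a' a t (delta y) x.
Proof.
  intros Hx Hy. destruct (dual_lyapunov isZ lam mu Hlam Hmu Hmu0 Hnat) as [h [C HL]].
  apply (transition_function_semi a' a h C dual_rates HL isZ (fun x => mu (x + 1)%Z) lam);
    auto using dual_absorbing.
  intros z Hz. unfold a', a, b, extend. now rewrite Hz, (inIb_succ isZ z Hz).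
Qed.

Lemma primal_reversible (x y : Z) : inIb isZ x = true -> inIb isZ y = true ->
  piF lam mu x * p t x y = piF lam mu y * p t y x.
Proof.
  intros Hx Hy. destruct (primal_lyapunov isZ lam mu Hlam Hmu Hnat) as [h [C HL]].
  rewrite !primal_semi by auto.
  apply (semi_reversible (inIb isZ) a b h (piF lam mu) C); auto using primal_absorbing.
  - now apply extend_rates.
  - intros z Hz Hz'. unfold a, b, extend. rewrite Hz, Hz'.
    rewrite Rmult_comm, (piF_step isZ) by auto. ring.
Qed.

Lemma dual_reversible (x y : Z) : inIb isZ x = true -> inIb isZ y = true ->
  pihat lam mu x * ph t x y = pihat lam mu y * ph t y x.
Proof.
  intros Hx Hy. destruct (dual_lyapunov isZ lam mu Hlam Hmu Hmu0 Hnat) as [h [C HL]].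
  rewrite !dual_semi by auto.
  apply (semi_reversible (inIb isZ) a' a h (pihat lam mu) C); auto using dual_absorbing.
  - apply dual_rates.
  - intros z Hz Hz'. unfold a', a, b, extend. rewrite Hz'. now apply (pihat_step isZ).
Qed.

Lemma dual_cdf (x y : Z) : semi a' a t (indic (fun w => x <=? w)%Z) y = cdf x y.
Proof.
  destruct (primal_lyapunov isZ lam mu Hlam Hmu Hnat) as [h [C HL]].
  destruct (dual_lyapunov isZ lam mu Hlam Hmu Hmu0 Hnat) as [h' [C' HL']].
  symmetry. apply (semi_dual a b h h' C C'); auto. now apply extend_rates.
Qed.

(** On [N], [mu 0 = 0] keeps the chain out of the negative integers, so [f - g], which is zero on
    [I], is stationary. This reconciles the cells, confined to [I], with the half-lines of [cdf]. *)
Lemma primal_semi_support (f g : Z -> R) (B : R) (x : Z) :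
  (forall z, Rabs (f z) <= B) -> (forall z, Rabs (g z) <= B) ->
  (forall z, inIb isZ z = true -> f z = g z) -> inIb isZ x = true ->
  semi a b t f x = semi a b t g x.
Proof.
  intros Hf Hg Hfg Hx. destruct (primal_lyapunov isZ lam mu Hlam Hmu Hnat) as [h [C HL]].
  assert (Hab : rates a b) by now apply extend_rates.
  enough (1 * semi a b t f x + -1 * semi a b t g x = 0) by lra.
  rewrite <- (semi_lin a b h C Hab HL f g B B) by auto.
  rewrite (semi_stationary a b h C Hab HL _ (B + B)); auto.
  - rewrite Hfg by auto. ring.
  - intros z. replace (_ + _) with (f z - g z) by ring.
    eapply Rle_trans; [apply Rabs_triang|]. rewrite Rabs_Ropp. now apply Rplus_le_compat.
  - intros z. unfold gen. destruct (inIb isZ z) eqn:E.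
    + rewrite (Hfg z), (Hfg (z + 1)%Z) by auto using inIb_succ.
      destruct (inIb isZ (z - 1)%Z) eqn:E'; [rewrite (Hfg (z - 1)%Z) by auto; ring|].
      replace (b z) with 0; [ring|]. symmetry. replace z with (z - 1 + 1)%Z by lia.
      now apply (extend_mu_succ isZ).
    + destruct (primal_absorbing z E) as [-> ->]. ring.
Qed.

(** [cdf] with the convention that [y_n] is infinite; the value 1 is honesty. *)
Let top (n : nat) (y : list Z) (j : nat) (x : Z) : R :=
  if Nat.ltb j n then cdf x (nthZ j y) else 1.

Lemma semi_cell_up (n : nat) (y : list Z) (j : nat) (x : Z) :
  inW isZ n y = true -> (j <= n)%nat -> inIb isZ x = true ->
  semi a b t (indic (cell_up isZ n y j)) x =
  match j with O => top n y O x | S k => top n y j x - top n y k x end.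
Proof.
  intros Hy Hj Hx. apply inW_spec in Hy. destruct Hy as (_ & _ & Hy).
  destruct (primal_lyapunov isZ lam mu Hlam Hmu Hnat) as [h [C HL]].
  assert (Hab : rates a b) by now apply extend_rates.
  set (U := fun j w => negb (Nat.ltb j n) || (w <=? nthZ j y)%Z).
  assert (HU : forall j, semi a b t (indic (U j)) x = top n y j x).
  { intros i. unfold U, top. destruct (Nat.ltb i n); [reflexivity|].
    apply (semi_const a b h C Hab HL 1); auto. }
  destruct j as [|k].
  - rewrite <- HU. apply (primal_semi_support _ _ 1); auto using indic_bound.
    intros z Hz. unfold indic, cell_up. rewrite Hz. simpl. now rewrite andb_true_r.
  - rewrite <- !HU.
    replace (semi a b t (indic (U (S k))) x - semi a b t (indic (U k)) x)
      with (1 * semi a b t (indic (U (S k))) x + -1 * semi a b t (indic (U k)) x) by ring.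
    rewrite <- (semi_lin a b h C Hab HL _ _ 1 1) by auto using indic_bound.
    apply (primal_semi_support _ _ 2); auto.
    + intros z. pose proof (indic_bound (cell_up isZ n y (S k)) z). lra.
    + intros z. unfold indic. apply Rabs_le. destruct (U (S k) z), (U k z); lra.
    + intros z Hz. unfold indic, cell_up, U. rewrite Hz.
      replace (S k - 1)%nat with k by lia. simpl Nat.eqb.
      rewrite (proj2 (Nat.ltb_lt k n)) by lia. simpl negb. simpl orb. simpl andb.
      destruct (Nat.ltb_spec (S k) n) as [Hk|Hk]; simpl.
      * specialize (Hy k Hk).
        destruct (Z.leb_spec z (nthZ (S k) y)), (Z.ltb_spec (nthZ k y) z),
          (Z.leb_spec z (nthZ k y)); simpl; try lia; ring.
      * destruct (Z.ltb_spec (nthZ k y) z), (Z.leb_spec z (nthZ k y)); simpl; try lia; ring.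
Qed.

Lemma dual_semi_diff (c : Z -> bool) (u v x : Z) :
  (forall w, c w = (u <=? w) && (w <? v))%Z -> (u < v)%Z ->
  semi a' a t (indic c) x = cdf u x - cdf v x.
Proof.
  intros Hc Huv. destruct (dual_lyapunov isZ lam mu Hlam Hmu Hmu0 Hnat) as [h [C HL]].
  rewrite <- !dual_cdf.
  match goal with |- _ = ?r - ?s => replace (r - s) with (1 * r + -1 * s) by ring end.
  rewrite <- (semi_lin a' a h C dual_rates HL _ _ 1 1) by auto using indic_bound.
  apply (f_equal (fun f => semi a' a t f x)). apply functional_extensionality. intros w.
  unfold indic. rewrite Hc.
  destruct (Z.leb_spec u w), (Z.ltb_spec w v), (Z.leb_spec v w); simpl; try lia; ring.
Qed.

Lemma primal_kernel_sum (c : Z -> bool) (x : Z) :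
  (forall w, c w = true -> inIb isZ w = true) -> inIb isZ x = true ->
  is_lim_seq (fun N => sumL (zrange N) (fun w => if c w then p t x w else 0))
    (semi a b t (indic c) x).
Proof.
  intros Hc Hx. destruct (primal_lyapunov isZ lam mu Hlam Hmu Hnat) as [h [C HL]].
  assert (Hab : rates a b) by now apply extend_rates.
  apply is_lim_seq_ext with (2 := semi_kernel_sum a b h C Hab HL c t x Ht).
  intros N. apply sumL_ext. intros w _. destruct (c w) eqn:E; auto.
  now rewrite primal_semi by auto.
Qed.

Lemma dual_kernel_sum (c : Z -> bool) (x : Z) :
  (forall w, c w = true -> inIb isZ w = true) -> inIb isZ x = true ->
  is_lim_seq (fun N => sumL (zrange N) (fun w => if c w then ph t x w else 0))
    (semi a' a t (indic c) x).
Proof.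
  intros Hc Hx. destruct (dual_lyapunov isZ lam mu Hlam Hmu Hmu0 Hnat) as [h [C HL]].
  apply is_lim_seq_ext with (2 := semi_kernel_sum a' a h C dual_rates HL c t x Ht).
  intros N. apply sumL_ext. intros w _. destruct (c w) eqn:E; auto.
  now rewrite dual_semi by auto.
Qed.

(** The series runs over the starting point; reversibility turns it into one over the end point,
    where [primal_kernel_sum] applies. *)
Lemma primal_reversed_sum (c : Z -> bool) (y : Z) :
  (forall w, c w = true -> inIb isZ w = true) -> inIb isZ y = true ->
  is_lim_seq (fun N => sumL (zrange N) (fun w => if c w then piF lam mu w * p t w y else 0))
    (piF lam mu y * semi a b t (indic c) y).
Proof.
  intros Hc Hy. apply is_lim_seq_ext with
    (fun N => piF lam mu y * sumL (zrange N) (fun w => if c w then p t y w else 0)).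
  - intros N. rewrite <- sumL_scal. apply sumL_ext. intros w _.
    destruct (c w) eqn:E; [|ring]. now rewrite (primal_reversible w y) by auto.
  - apply is_lim_seq_mult'; [apply is_lim_seq_const|now apply primal_kernel_sum].
Qed.

Lemma dual_reversed_sum (c : Z -> bool) (y : Z) :
  (forall w, c w = true -> inIb isZ w = true) -> inIb isZ y = true ->
  is_lim_seq (fun N => sumL (zrange N) (fun w => if c w then pihat lam mu w * ph t w y else 0))
    (pihat lam mu y * semi a' a t (indic c) y).
Proof.
  intros Hc Hy. apply is_lim_seq_ext with
    (fun N => pihat lam mu y * sumL (zrange N) (fun w => if c w then ph t y w else 0)).
  - intros N. rewrite <- sumL_scal. apply sumL_ext. intros w _.
    destruct (c w) eqn:E; [|ring]. now rewrite (dual_reversible w y) by auto.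
  - apply is_lim_seq_mult'; [apply is_lim_seq_const|now apply dual_kernel_sum].
Qed.

Lemma kcomp_KM_left (q : R -> Z -> Z -> R) (w : Z -> R) (m N : nat) (x y : list Z)
  (il : list Z -> list Z -> bool) (c : nat -> Z -> bool) :
  (forall z, length z = m ->
    inW isZ m z && il z y = forallb (fun j => c j (nthZ j z)) (seq 0 m)) ->
  kcomp_trunc isZ m (KM q t m) (fun z y => if il z y then prodL w y else 0) x y N
  = prodL w y * det m (fun i j =>
      sumL (zrange N) (fun v => if c j v then q t (nthZ i x) v else 0)).
Proof.
  intros Hc. unfold kcomp_trunc.
  rewrite <- (box_sum_det N m c (fun i v => q t (nthZ i x) v)), <- sumL_scal.
  apply sumL_ext. intros z Hz. rewrite <- Hc by (now apply in_box_length in Hz).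
  unfold KM. destruct (inW isZ m z), (il z y); simpl; ring.
Qed.

Lemma kcomp_KM_right (q : R -> Z -> Z -> R) (w : Z -> R) (m N : nat) (x y : list Z)
  (il : list Z -> list Z -> bool) (c : nat -> Z -> bool) :
  (forall z, il x z = true -> inW isZ m z = true) ->
  (forall z, length z = m -> il x z = forallb (fun j => c j (nthZ j z)) (seq 0 m)) ->
  kcomp_trunc isZ m (fun x z => if il x z then prodL w z else 0) (KM q t m) x y N
  = det m (fun i j =>
      sumL (zrange N) (fun v => if c j v then w v * q t v (nthZ i y) else 0)).
Proof.
  intros HW Hc. unfold kcomp_trunc.
  rewrite <- (box_sum_det N m c (fun i v => w v * q t v (nthZ i y))).
  apply sumL_ext. intros z Hz. apply in_box_length in Hz. rewrite <- Hc by auto.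
  destruct (il x z) eqn:E.
  - rewrite HW by auto. unfold KM.
    (* In [KM] the summed configuration indexes the rows. The weights go into these rows and the
       matrix is transposed, so that each summed coordinate occupies one column as in
       [box_sum_det]. *)
    rewrite <- Hz, <- prodL_det. symmetry.
    apply (det_transpose _ (fun i j => w (nthZ i z) * q t (nthZ i z) (nthZ j y))).
  - destruct (inW isZ m z); ring.
Qed.

Lemma intertwining_up (n : nat) (x y : list Z) :
  (1 <= n)%nat -> inW isZ (S n) x = true -> inW isZ n y = true ->
  exists L : R,
    Un_cv (kcomp_trunc isZ (S n) (KM p t (S n)) (Lam_nn1 isZ lam mu n) x y) L /\
    Un_cv (kcomp_trunc isZ n (Lam_nn1 isZ lam mu n) (KM ph t n) x y) L.
Proof.
  intros Hn Hx Hy. destruct (proj1 (inW_spec _ _ _) Hx) as (Lx & Ix & Ox).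
  destruct (proj1 (inW_spec _ _ _) Hy) as (Ly & Iy & Oy).
  exists (prodL (pihat lam mu) y *
    det n (fun i j => cdf (nthZ i x) (nthZ j y) - cdf (nthZ (S i) x) (nthZ j y))).
  split; apply is_lim_seq_Reals.
  - apply is_lim_seq_ext with (1 := fun N => eq_sym (kcomp_KM_left p (pihat lam mu) (S n) N x y
      (in_Wnn1 isZ n) (cell_up isZ n y) (fun z Hz => interlace_up isZ n y z Hy Hz))).
    apply is_lim_seq_mult'; [apply is_lim_seq_const|].
    (* A square matrix of size [n + 1] whose last column is 1; its column differences are the cell
       masses on the left side. *)
    set (D := fun i j => top n y j (nthZ i x)).
    replace (det n _) with
      (det (S n) (fun i j => match j with O => D i O | S k => D i j - D i k end)).
    + apply det_cv. intros i j Hi Hj.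
      unfold D. rewrite <- semi_cell_up by (auto; lia).
      apply primal_kernel_sum; auto. intros w. unfold cell_up.
      now intros [[H _]%andb_true_iff _]%andb_true_iff.
    + transitivity (det (S n) D).
      { rewrite <- (det_column_differences (S n) D). apply det_ext. intros i [|j]; reflexivity. }
      (* Row differences cancel the ones except in the last row, and expansion along that column
         leaves the determinant of size [n]. *)
      rewrite <- (det_row_differences (S n) D), det_last_column_unit.
      * apply det_ext. intros i j Hi Hj. unfold D, top.
        rewrite (proj2 (Nat.ltb_lt (S i) (S n))), (proj2 (Nat.ltb_lt j n)) by lia. reflexivity.
      * intros i Hi. unfold D, top. rewrite (proj2 (Nat.ltb_lt (S i) (S n))), Nat.ltb_irrefl by lia.
        apply Rminus_diag.
      * unfold D, top. now rewrite !Nat.ltb_irrefl.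
  - apply is_lim_seq_ext with (1 := fun N => eq_sym (kcomp_KM_right ph (pihat lam mu) n N x y
      (in_Wnn1 isZ n) (cell_between x) (fun z Hz => proj1 (andb_prop _ _ Hz))
      (fun z Hz => interlace_between isZ n x z Hx Hz))).
    (* Reversing the dual kernel leaves a factor [pihat] at each coordinate of [y]; after the
       transposition [y] indexes the rows and the product is absorbed there. *)
    rewrite <- (det_transpose n), <- Ly, <- prodL_det, Ly.
    apply det_cv. intros i j Hi Hj.
    rewrite <- (dual_semi_diff (cell_between x j)); [|reflexivity|apply Ox; lia].
    apply dual_reversed_sum; auto.
    intros w Hw. apply inIb_mono with (nthZ j x); [|apply Ix; lia].
    unfold cell_between in Hw. lia.
Qed.

Lemma intertwining_same (n : nat) (x y : list Z) :
  (1 <= n)%nat -> inW isZ n x = true -> inW isZ n y = true ->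
  exists L : R,
    Un_cv (kcomp_trunc isZ n (KM ph t n) (Lam_nn isZ lam mu n) x y) L /\
    Un_cv (kcomp_trunc isZ n (Lam_nn isZ lam mu n) (KM p t n) x y) L.
Proof.
  intros Hn Hx Hy. destruct (proj1 (inW_spec _ _ _) Hx) as (Lx & Ix & Ox).
  destruct (proj1 (inW_spec _ _ _) Hy) as (Ly & Iy & Oy).
  (* Row differences of this matrix are the dual masses of the cells [cell_right] of [y], column
     differences the primal masses of the cells [cell_up] of [x]. The last dual cell is a whole
     half-line, which matches the last row staying undifferenced. *)
  exists (prodL (piF lam mu) y * det n (fun i j => cdf (nthZ i y) (nthZ j x))).
  split; apply is_lim_seq_Reals.
  - apply is_lim_seq_ext with (1 := fun N => eq_sym (kcomp_KM_left ph (piF lam mu) n N x y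
      (in_Wnn isZ n) (cell_right n y) (fun z Hz => interlace_right isZ n y z Hy Hz))).
    apply is_lim_seq_mult'; [apply is_lim_seq_const|].
    rewrite <- det_row_differences, <- det_transpose.
    apply det_cv. intros i j Hi Hj.
    replace (if Nat.ltb (S j) n then _ else _)
      with (semi a' a t (indic (cell_right n y j)) (nthZ i x)).
    + apply dual_kernel_sum; auto.
      intros w Hw. apply inIb_mono with (nthZ j y); [|now apply Iy].
      unfold cell_right in Hw. lia.
    + destruct (Nat.ltb_spec (S j) n) as [H|H].
      * apply dual_semi_diff; [|now apply Oy]. intros w. unfold cell_right.
        now rewrite (proj2 (Nat.ltb_lt (S j) n)) by auto.
      * rewrite <- dual_cdf. apply (f_equal (fun f => semi a' a t f _)).
        apply functional_extensionality. intros w. unfold indic, cell_right.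
        rewrite (proj2 (Nat.ltb_ge (S j) n)) by auto. simpl. now rewrite andb_true_r.
  - apply is_lim_seq_ext with (1 := fun N => eq_sym (kcomp_KM_right p (piF lam mu) n N x y
      (in_Wnn isZ n) (cell_up isZ n x)
      (fun z Hz => proj1 (andb_prop _ _ (proj1 (andb_prop _ _ Hz))))
      (fun z Hz => interlace_left isZ n x z Hz))).
    rewrite <- (det_column_differences n), <- Ly at 1. rewrite <- prodL_det, Ly.
    apply det_cv. intros i j Hi Hj.
    replace (match j with O => _ | S _ => _ end)
      with (semi a b t (indic (cell_up isZ n x j)) (nthZ i y)).
    + apply primal_reversed_sum; auto. intros w. unfold cell_up.
      now intros [[H _]%andb_true_iff _]%andb_true_iff.
    + rewrite semi_cell_up by (auto; lia). unfold top.
      destruct j as [|k]; [now rewrite (proj2 (Nat.ltb_lt 0 n)) by auto|].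
      now rewrite (proj2 (Nat.ltb_lt (S k) n)), (proj2 (Nat.ltb_lt k n)) by lia.
Qed.

End Intertwining.

Theorem theorem1p1
  (isZ : bool) (lam mu : Z -> R)
  (Hlam : forall x : Z, inIb isZ x = true -> 0 < lam x)
  (Hmu : forall x : Z, inIb isZ x = true -> (isZ = true \/ x <> 0%Z) -> 0 < mu x)
  (Hmu0 : isZ = false -> mu 0%Z = 0)
  (Hnat : natural_boundaries isZ lam mu)
  (p ph : R -> Z -> Z -> R)
  (Hp : transition_function isZ lam mu p)
  (Hph : transition_function isZ (fun x => mu (x + 1)%Z) lam ph)
  (n : nat) (t : R) (Hn : (1 <= n)%nat) (Ht : 0 <= t) :
  (forall x y' : list Z, inW isZ (S n) x = true -> inW isZ n y' = true ->
     exists L : R,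
       Un_cv (kcomp_trunc isZ (S n) (KM p t (S n)) (Lam_nn1 isZ lam mu n) x y') L /\
       Un_cv (kcomp_trunc isZ n (Lam_nn1 isZ lam mu n) (KM ph t n) x y') L) /\
  (forall x y' : list Z, inW isZ n x = true -> inW isZ n y' = true ->
     exists L : R,
       Un_cv (kcomp_trunc isZ n (KM ph t n) (Lam_nn isZ lam mu n) x y') L /\
       Un_cv (kcomp_trunc isZ n (Lam_nn isZ lam mu n) (KM p t n) x y') L).
Proof.
  split; intros x y' Hx Hy.
  - now apply intertwining_up.
  - now apply intertwining_same.
Qed.
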